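(* Balanced Cluster Deletion admits an algorithm running in time $2^{k}\cdot n^{\mathcal{O}(1)}$, where $n$ is the number of vertices of the input graph.
   Context: All graphs are finite and simple. A cluster graph is a graph in which every connected component is a clique. For a non-negative integer $\eta$, a graph is $\eta$-balanced if for any two connected components $H,H'$ we have $\big||V(H)|-|V(H')|\big|\le\eta$. Balanced Cluster Deletion: given a graph $G$ and non-negative integers $k,\eta$, decide whether there is $F\subseteq E(G)$ with $|F|\le k$ such that $(V(G),E(G)\setminus F)$ is an $\eta$-balanced cluster graph. *)

(* Defs.v *)
From mathcomp Require Import all_boot all_algebra.

Set Implicit Arguments.
Unset Strict Implicit.
Unset Printing Implicit Defensive.

(** * Balanced Cluster Deletion *)

Record sgraph (T : finType) := SGraph {
  edges : {set {set T}};
  edges_card2 : forall e, e \in edges -> #|e| = 2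
}.

Section Graphs.
Variable T : finType.
Implicit Type G : sgraph T.

(* [set x; x] is a singleton, hence never an edge: adj is irreflexive. *)
Definition adj G : rel T := [rel x y | [set x; y] \in edges G].

Lemma del_edges_card2 G (F : {set {set T}}) e :
  e \in edges G :\: F -> #|e| = 2.
Proof. by case/setDP => /edges_card2. Qed.

Definition del_edges G (F : {set {set T}}) : sgraph T :=
  SGraph (@del_edges_card2 G F).

Definition component G (x : T) : {set T} := [set y | connect (adj G) x y].

Definition components G : {set {set T}} := [set component G x | x : T].

Definition clique G (C : {set T}) : Prop :=
  forall x y, x \in C -> y \in C -> x != y -> adj G x y.

Definition cluster_graph G : Prop :=
  forall H, H \in components G -> clique G H.

(* absz parses its argument in distn_scope: the subtraction is that of int. *)
Definition balanced (eta : nat) G : Prop :=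
  forall H H', H \in components G -> H' \in components G ->
    absz (#|H| - #|H'|) <= eta.

Definition balanced_cluster_deletion G (k eta : nat) : Prop :=
  exists F : {set {set T}},
    [/\ F \subset edges G, #|F| <= k,
        cluster_graph (del_edges G F) & balanced eta (del_edges G F)].

End Graphs.

(** * Random access machines *)

(* A RAM with unbounded natural-number cells and unit cost per instruction.
   The only arithmetic is addition and truncated subtraction, so t steps
   lengthen the binary representation of the numbers by at most t bits (up to
   the constants of the program) and time is polynomially related to Turing
   machine time; unit-cost multiplication would break this. A program mentions
   finitely many registers; memory is reached only by indirection. *)

Inductive instr :=
| IConst of nat & nat        (* IConst d c   : R[d] := c *)
| IAdd of nat & nat & nat    (* IAdd d a b   : R[d] := R[a] + R[b] *)
| ISub of nat & nat & nat    (* ISub d a b   : R[d] := R[a] - R[b], truncated *)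
| IRead of nat & nat         (* IRead d a    : R[d] := M[R[a]] *)
| IWrite of nat & nat        (* IWrite a s   : M[R[a]] := R[s] *)
| IJump of nat               (* IJump l      : goto l *)
| IJumpZ of nat & nat        (* IJumpZ a l   : if R[a] = 0 then goto l *)
| IHalt.

Definition program := seq instr.

Record config := Config { pc : nat; reg : nat -> nat; mem : nat -> nat }.

Definition upd (f : nat -> nat) (a v : nat) : nat -> nat :=
  fun x => if x == a then v else f x.

(* Running off the end of the program is the same as reaching IHalt. *)
Definition fetch (P : program) (s : config) : instr := nth IHalt P (pc s).

Definition step (P : program) (s : config) : config :=
  let: Config l R M := s in
  match fetch P s with
  | IConst d c => Config l.+1 (upd R d c) M
  | IAdd d a b => Config l.+1 (upd R d (R a + R b)) M
  | ISub d a b => Config l.+1 (upd R d (R a - R b)) M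
  | IRead d a => Config l.+1 (upd R d (M (R a))) M
  | IWrite a r => Config l.+1 R (upd M (R a) (R r))
  | IJump l' => Config l' R M
  | IJumpZ a l' => Config (if R a == 0 then l' else l.+1) R M
  | IHalt => s
  end.

Definition halted (P : program) (s : config) : Prop := fetch P s = IHalt.

Definition run (P : program) (t : nat) (s : config) : config :=
  iter t (step P) s.

(* An instance (G, k, eta) with vertex set {0, ..., n-1}: registers 0, 1, 2 hold
   n, k, eta, and memory holds the adjacency matrix of G in row-major order from
   address 0; everything else is 0. *)
Definition input (n : nat) (G : sgraph 'I_n) (k eta : nat) : config :=
  Config 0 (nth 0 [:: n; k; eta])
    (fun a => [exists u : 'I_n, exists v : 'I_n, (a == u * n + v) && adj G u v]).

(* The answer is read in register 0: nonzero means yes. *)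
Definition accepting (s : config) : Prop := reg s 0 != 0.

(* Main.v *)
Require Import Defs.
From mathcomp Require Import all_boot zify.

(** An induced path u - v - w forces every solution to delete uv or vw, so
    branching on such paths gives a search tree of depth k, of which only the
    leaves that are cluster graphs matter. At such a leaf, fix the least part size s: every clique has to
    be split into parts of sizes between s and s + eta, and the cheapest way to do
    this is found by dynamic programming on the size of the clique. Since at most
    n^2 edges can be deleted, k may be replaced by K := min(k, n^2).

    The machine walks through the tree without recursion: each x < 2^K encodes the
    branching choices on one root-to-leaf path, read from the most significant bit
    by repeated doubling. The program is written in a small language of bounded
    loops, whose loop bounds are registers fixed in advance, so that running times
    can be read off the syntax. *)

Set Implicit Arguments.
Unset Strict Implicit.
Unset Printing Implicit Defensive.

(** * A language of bounded loops *)

(** The time bound is exponential only through [2^k] and does not depend on [eta], so no inner loop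
    may be bounded by [k], [eta] or [2^K]. Inner loops have length [n], [n^2], [K] or [n+1], all
    polynomial in [n]; only the outermost loop runs [2^K] times. No node of the search tree is
    stored: each path is replayed from the untouched input matrix, always for exactly [K] steps, a
    bit being consumed even when no induced path is left. The walk is justified differently in the
    two directions. Whatever the bits, a solution at the end of a path lifts to the input;
    conversely, from a solvable input some bit string leads to a solvable cluster graph. The least
    part size [s] is tried exhaustively because balance relates all cliques to each other; once [s]
    is fixed, each clique can be split on its own. Cutting a part of size [p] off a clique on [m]
    vertices deletes [p (m - p)] edges, which is the recursion of the dynamic program. *)

(* Binders are functions on nat: [eval] and [sem] feed them values, the compiler
   feeds them register names. *)
Inductive exp :=
| ECst of nat
| EReg of nat
| EVar of nat
| EAdd of exp & exp
| ESub of exp & exp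
| ERead of exp
| EIte of exp & exp & exp
| EFold of nat & exp & (nat -> nat -> exp).

Inductive cmd :=
| CSkip
| CAsgn of nat & exp
| CWrite of exp & exp
| CSeq of cmd & cmd
| CIf of exp & cmd & cmd
| CLet of exp & (nat -> cmd)
| CFor of nat & (nat -> cmd).

Definition state := ((nat -> nat) * (nat -> nat))%type.

Fixpoint eval (e : exp) (s : state) : nat :=
  match e with
  | ECst c => c
  | EReg r => s.1 r
  | EVar v => v
  | EAdd e1 e2 => eval e1 s + eval e2 s
  | ESub e1 e2 => eval e1 s - eval e2 s
  | ERead e1 => s.2 (eval e1 s)
  | EIte e1 e2 e3 => if eval e1 s == 0 then eval e3 s else eval e2 s
  | EFold r e0 f => iteri (s.1 r) (fun i acc => eval (f acc i) s) (eval e0 s)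
  end.

Fixpoint sem (c : cmd) (s : state) : state :=
  match c with
  | CSkip => s
  | CAsgn r e => (upd s.1 r (eval e s), s.2)
  | CWrite e1 e2 => (s.1, upd s.2 (eval e1 s) (eval e2 s))
  | CSeq c1 c2 => sem c2 (sem c1 s)
  | CIf e c1 c2 => if eval e s == 0 then sem c2 s else sem c1 s
  | CLet e f => sem (f (eval e s)) s
  | CFor r f => iteri (s.1 r) (fun i => sem (f i)) s
  end.

(* [comp e d l] is code for address [l] that leaves the value of [e] in register
   [d] and overwrites only registers from [d] on. *)
Fixpoint comp (e : exp) (d l : nat) : program :=
  match e with
  | ECst c => [:: IConst d c]
  | EReg r => [:: IConst d 0; IAdd d d r]
  | EVar r => [:: IConst d 0; IAdd d d r]
  | EAdd e1 e2 =>
      let c1 := comp e1 d l in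
      let c2 := comp e2 d.+1 (l + size c1) in
      c1 ++ c2 ++ [:: IAdd d d d.+1]
  | ESub e1 e2 =>
      let c1 := comp e1 d l in
      let c2 := comp e2 d.+1 (l + size c1) in
      c1 ++ c2 ++ [:: ISub d d d.+1]
  | ERead e1 => comp e1 d l ++ [:: IRead d d]
  | EIte e1 e2 e3 =>
      let c1 := comp e1 d l in
      let c2 := comp e2 d (l + size c1).+1 in
      let l3 := ((l + size c1).+1 + size c2).+1 in
      let c3 := comp e3 d l3 in
      c1 ++ IJumpZ d l3 :: c2 ++ IJump (l3 + size c3) :: c3
  | EFold r e0 f =>
      let c0 := comp e0 d l in
      let ll := (l + size c0).+1 in
      let cb := comp (f d d.+1) d.+2 ll.+2 in
      c0 ++ IConst d.+1 0 :: ISub d.+2 r d.+1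
        :: IJumpZ d.+2 (ll.+2 + size cb + 5)
        :: cb ++ [:: IConst d 0; IAdd d d d.+2; IConst d.+2 1;
                     IAdd d.+1 d.+1 d.+2; IJump ll]
  end.

Fixpoint compc (c : cmd) (d l : nat) : program :=
  match c with
  | CSkip => [::]
  | CAsgn r e => comp e d l ++ [:: IConst r 0; IAdd r r d]
  | CWrite e1 e2 =>
      let c1 := comp e1 d l in
      let c2 := comp e2 d.+1 (l + size c1) in
      c1 ++ c2 ++ [:: IWrite d d.+1]
  | CSeq a b => let ca := compc a d l in ca ++ compc b d (l + size ca)
  | CIf e a b =>
      let c1 := comp e d l in
      let c2 := compc a d (l + size c1).+1 in
      let l3 := ((l + size c1).+1 + size c2).+1 in
      let c3 := compc b d l3 in
      c1 ++ IJumpZ d l3 :: c2 ++ IJump (l3 + size c3) :: c3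
  | CLet e f =>
      let c1 := comp e d l in c1 ++ compc (f d) d.+1 (l + size c1)
  | CFor r f =>
      let cb := compc (f d) d.+1 l.+3 in
      IConst d 0 :: ISub d.+1 r d :: IJumpZ d.+1 (l.+3 + size cb + 3)
        :: cb ++ [:: IConst d.+1 1; IAdd d d d.+1; IJump l.+1]
  end.

(* Costs do not depend on bound variables, which are instantiated by dummies. *)
Fixpoint cost (e : exp) (R : nat -> nat) : nat :=
  match e with
  | ECst _ => 1
  | EReg _ | EVar _ => 2
  | EAdd e1 e2 | ESub e1 e2 => cost e1 R + cost e2 R + 1
  | ERead e1 => cost e1 R + 1
  | EIte e1 e2 e3 => cost e1 R + (cost e2 R + cost e3 R + 2)
  | EFold r e0 f => cost e0 R + (3 + R r * (cost (f 0 0) R + 7))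
  end.

Fixpoint costc (c : cmd) (R : nat -> nat) : nat :=
  match c with
  | CSkip => 0
  | CAsgn _ e => cost e R + 2
  | CWrite e1 e2 => cost e1 R + cost e2 R + 1
  | CSeq a b => costc a R + costc b R
  | CIf e a b => cost e R + (costc a R + costc b R + 2)
  | CLet e f => cost e R + costc (f 0) R
  | CFor r f => 3 + R r * (costc (f 0) R + 5)
  end.

(** * Execution of code fragments *)

Definition code_at (P : program) (l : nat) (c : program) : Prop :=
  forall i, i < size c -> nth IHalt P (l + i) = nth IHalt c i.

Lemma code_at_cat P l c1 c2 :
  code_at P l (c1 ++ c2) -> code_at P l c1 /\ code_at P (l + size c1) c2.
Proof.
move=> H; split=> i Hi.
  by rewrite H ?nth_cat ?Hi // size_cat; lia.
rewrite -addnA H ?size_cat ?ltn_add2l // nth_cat ifN; last by lia.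
by rewrite addKn.
Qed.

Lemma code_at_cons P l i c :
  code_at P l (i :: c) -> nth IHalt P l = i /\ code_at P l.+1 c.
Proof.
move=> H; split; first by have := H 0 isT; rewrite addn0.
by move=> j Hj; rewrite addSnnS (H j.+1).
Qed.

(** An upper bound on the time instead of the exact time, so that both branches of a conditional fit
    one static cost. *)
Definition reach (P : program) (T : nat) (s s' : config) : Prop :=
  exists2 t, t <= T & run P t s = s'.

Lemma reach_refl P s : reach P 0 s s.
Proof. by exists 0. Qed.

Lemma reach_pc P R M l l' : l = l' -> reach P 0 (Config l R M) (Config l' R M).
Proof. by move=> ->; exists 0. Qed.

Lemma reach_trans P T1 T2 s1 s2 s3 :
  reach P T1 s1 s2 -> reach P T2 s2 s3 -> reach P (T1 + T2) s1 s3.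
Proof.
move=> [t1 H1 E1] [t2 H2 E2]; exists (t2 + t1); first by lia.
by rewrite /run iterD -/(run P t1 s1) E1.
Qed.

Lemma reach_leq P T1 T2 s s' : T1 <= T2 -> reach P T1 s s' -> reach P T2 s s'.
Proof. by move=> H [t Ht E]; exists t => //; apply: leq_trans H. Qed.

Lemma reach_step P T s s' : reach P T (step P s) s' -> reach P T.+1 s s'.
Proof. by move=> [t Ht E]; exists t.+1 => //; rewrite /run iterSr. Qed.

Lemma upd_same R a v : upd R a v a = v.
Proof. by rewrite /upd eqxx. Qed.

Lemma upd_other R a v x : x != a -> upd R a v x = R x.
Proof. by rewrite /upd => /negbTE->. Qed.

Ltac exec1 H := apply: reach_step; rewrite /step /fetch /= H.
Ltac upds := repeat (rewrite upd_same || (rewrite upd_other; last lia)).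

(** * Correctness of the compiler *)

(* Registers below [nvars] are program variables, those above are temporaries.
   Loop bounds are read from [loop_regs], which no command that has a static
   cost ([pcmd]) overwrites; [mut_regs] are the assignable registers. *)
Definition nvars := 13.
Definition loop_regs := [:: 0; 3; 4; 6].
Definition mut_regs := [:: 10; 11; 12].

Definition ctx := seq (nat * nat).

(* [pexp G e e'] : [e] and [e'] are instances of the same expression, bound
   variables being register names in [e] and their values in [e']; [G] lists
   the correspondence. *)
Inductive pexp : ctx -> exp -> exp -> Prop :=
| pCst G c : pexp G (ECst c) (ECst c)
| pReg G r : r < nvars -> pexp G (EReg r) (EReg r)
| pVar G x v : List.In (x, v) G -> pexp G (EVar x) (EVar v)
| pAdd G a a' b b' : pexp G a a' -> pexp G b b' -> pexp G (EAdd a b) (EAdd a' b')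
| pSub G a a' b b' : pexp G a a' -> pexp G b b' -> pexp G (ESub a b) (ESub a' b')
| pRead G a a' : pexp G a a' -> pexp G (ERead a) (ERead a')
| pIte G a a' b b' c c' : pexp G a a' -> pexp G b b' -> pexp G c c' ->
    pexp G (EIte a b c) (EIte a' b' c')
| pFold G r a a' f f' : r \in loop_regs -> pexp G a a' ->
    (forall x v y w, pexp [:: (x, v), (y, w) & G] (f x y) (f' v w)) ->
    pexp G (EFold r a f) (EFold r a' f').

Inductive pcmd : ctx -> cmd -> cmd -> Prop :=
| pSkip G : pcmd G CSkip CSkip
| pAsgn G r a a' : r \in mut_regs -> pexp G a a' ->
    pcmd G (CAsgn r a) (CAsgn r a')
| pWrite G a a' b b' : pexp G a a' -> pexp G b b' ->
    pcmd G (CWrite a b) (CWrite a' b')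
| pSeq G a a' b b' : pcmd G a a' -> pcmd G b b' -> pcmd G (CSeq a b) (CSeq a' b')
| pIf G e e' a a' b b' : pexp G e e' -> pcmd G a a' -> pcmd G b b' ->
    pcmd G (CIf e a b) (CIf e' a' b')
| pLetC G e e' f f' : pexp G e e' ->
    (forall x v, pcmd ((x, v) :: G) (f x) (f' v)) -> pcmd G (CLet e f) (CLet e' f')
| pFor G r f f' : r \in loop_regs ->
    (forall x v, pcmd ((x, v) :: G) (f x) (f' v)) -> pcmd G (CFor r f) (CFor r f').

Lemma pexp_cost G e e' R : pexp G e e' -> cost e R = cost e' R.
Proof.
elim=> //=.
- by move=> ? ? ? ? ? _ -> _ ->.
- by move=> ? ? ? ? ? _ -> _ ->.
- by move=> ? ? ? _ ->.
- by move=> ? ? ? ? ? ? ? _ -> _ -> _ ->.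
- by move=> ? r ? ? f f' _ _ -> _ /(_ 0 0 0 0) ->.
Qed.

Lemma pcmd_cost G c c' R : pcmd G c c' -> costc c R = costc c' R.
Proof.
elim=> //=.
- by move=> ? ? ? ? _ /pexp_cost->.
- by move=> ? ? ? ? ? /pexp_cost-> /pexp_cost->.
- by move=> ? ? ? ? ? _ -> _ ->.
- by move=> ? ? ? ? ? ? ? /pexp_cost-> _ -> _ ->.
- by move=> ? ? ? ? ? /pexp_cost-> _ /(_ 0 0) ->.
- by move=> ? ? ? ? _ _ /(_ 0 0) ->.
Qed.

Definition ctx_ok (G : ctx) (d : nat) (R : nat -> nat) : Prop :=
  forall x v, List.In (x, v) G -> nvars <= x < d /\ R x = v.

Lemma ctx_ok_agree G d R d' R' :
  ctx_ok G d R -> d <= d' -> (forall r, nvars <= r < d -> R' r = R r) ->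
  ctx_ok G d' R'.
Proof.
by move=> H Hd HR x v /H[Hx <-]; split; [lia | apply: HR].
Qed.

Lemma ctx_ok_cons G d R x v :
  nvars <= x < d -> R x = v -> ctx_ok G d R -> ctx_ok ((x, v) :: G) d R.
Proof. by move=> Hx Hv H y w [[<- <-]|/H]. Qed.

(** The instance [e] with register names is compiled, the instance [e'] with values is evaluated.
    Keeping all registers below [d] protects the program variables, the bound variables and the
    temporaries of enclosing expressions. *)
Definition sime (G : ctx) (e e' : exp) : Prop :=
  forall P d l R s, (forall r, r < nvars -> R r = s.1 r) -> nvars <= d ->
  ctx_ok G d R -> code_at P l (comp e d l) ->
  exists R', [/\ reach P (cost e' s.1) (Config l R s.2)
                   (Config (l + size (comp e d l)) R' s.2),
                 R' d = eval e' s & forall r, r < d -> R' r = R r].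

Lemma sime_bin G (op : exp -> exp -> exp) (I : nat -> nat -> nat -> instr)
    (f : nat -> nat -> nat) a a' b b' :
  (forall e1 e2 d l, comp (op e1 e2) d l =
    comp e1 d l ++ comp e2 d.+1 (l + size (comp e1 d l)) ++ [:: I d d d.+1]) ->
  (forall e1 e2 s, eval (op e1 e2) s = f (eval e1 s) (eval e2 s)) ->
  (forall e1 e2 R, cost (op e1 e2) R = cost e1 R + cost e2 R + 1) ->
  (forall P l R M d x y, nth IHalt P l = I d x y ->
     step P (Config l R M) = Config l.+1 (upd R d (f (R x) (R y))) M) ->
  sime G a a' -> sime G b b' -> sime G (op a b) (op a' b').
Proof.
move=> Hc He Hk Hs IHa IHb P d l R s HR Hd HG; rewrite Hc.
move=> /code_at_cat[Ca /code_at_cat[Cb /code_at_cons[Ci _]]].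
have [R1 [E1 V1 F1]] := IHa P d l R s HR Hd HG Ca.
have HR1 r : r < nvars -> R1 r = s.1 r.
  by move=> Hr; rewrite F1 ?HR //; apply: leq_trans Hd.
have [||R2 [E2 V2 F2]] := IHb P d.+1 _ R1 s HR1 _ _ Cb; first by lia.
  by apply: ctx_ok_agree HG _ _ => [|r Hr]; [|apply: F1]; lia.
exists (upd R2 d (f (R2 d) (R2 d.+1))); split.
- rewrite Hk; apply: reach_trans (reach_trans E1 E2) _.
  apply: reach_step; rewrite (Hs _ _ _ _ _ _ _ Ci) !size_cat /=.
  by rewrite addn1 !addnS addnA; apply: reach_refl.
- by rewrite upd_same He V2 F2 // V1.
- by move=> r Hr; rewrite upd_other ?F2 ?F1 //; lia.
Qed.

Lemma sime_Ite G a a' b b' c c' :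
  sime G a a' -> sime G b b' -> sime G c c' -> sime G (EIte a b c) (EIte a' b' c').
Proof.
move=> IHa IHb IHc P d l R s HR Hd HG /=.
move=> /code_at_cat[Ca /code_at_cons[C1 /code_at_cat[Cb /code_at_cons[C2 Cc]]]].
have [R1 [E1 V1 F1]] := IHa P d l R s HR Hd HG Ca.
have HR1 r : r < nvars -> R1 r = s.1 r.
  by move=> Hr; rewrite F1 ?HR //; apply: leq_trans Hd.
have HG1 : ctx_ok G d R1 by apply: ctx_ok_agree HG _ _ => // r Hr; apply: F1; lia.
have [z|z] := boolP (eval a' s == 0).
  have [R2 [E2 V2 F2]] := IHc P d _ R1 s HR1 Hd HG1 Cc.
  exists R2; split=> //; last by move=> r Hr; rewrite F2 ?F1.
  apply: reach_trans E1 _.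
  apply: (@reach_leq _ (cost c' s.1).+1); first by lia.
  exec1 C1; rewrite V1 z.
  rewrite -[cost c' _]addn0; apply: reach_trans E2 _; apply: reach_pc.
  by rewrite size_cat /= size_cat /=; lia.
have [R2 [E2 V2 F2]] := IHb P d _ R1 s HR1 Hd HG1 Cb.
exists R2; split=> //; last by move=> r Hr; rewrite F2 ?F1.
apply: reach_trans E1 _.
apply: (@reach_leq _ (cost b' s.1 + 1).+1); first by lia.
exec1 C1; rewrite V1 (negbTE z).
apply: reach_trans E2 _; exec1 C2.
by apply: reach_pc; rewrite size_cat /= size_cat /=; lia.
Qed.

(** Register [d] holds the accumulator, [d.+1] the counter, and [d.+2] is scratch for the loop test
    and the value of the body. The last hypothesis makes one time bound serve for every round. *)
Lemma sime_Fold G r a a' f f' :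
  r < nvars -> sime G a a' ->
  (forall x v y w, sime [:: (x, v), (y, w) & G] (f x y) (f' v w)) ->
  (forall R v w, cost (f' v w) R = cost (f' 0 0) R) ->
  sime G (EFold r a f) (EFold r a' f').
Proof.
move=> Hr IHa IHf Hk P d l R s HR Hd HG /=.
set la := l + size (comp a d l); set cb := comp (f d d.+1) d.+2 la.+3.
move=> /code_at_cat[Ca]; rewrite -/la.
move=> /code_at_cons[C1 /code_at_cons[C2 /code_at_cons[C3 /code_at_cat[Cb]]]].
move=> /code_at_cons[C4 /code_at_cons[C5 /code_at_cons[C6]]].
move=> /code_at_cons[C7 /code_at_cons[C8 _]].
have [R1 [E1 V1 F1]] := IHa P d l R s HR Hd HG Ca.
pose N := s.1 r.
pose v i := iteri i (fun i acc => eval (f' acc i) s) (eval a' s).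
(* Two instructions test the bound and five close the round. *)
pose T := cost (f' 0 0) s.1 + 7.
have loop i : i <= N -> exists R', [/\ reach P (i * T) (Config la.+1 (upd R1 d.+1 0) s.2)
     (Config la.+1 R' s.2), R' d = v i, R' d.+1 = i & forall q, q < d -> R' q = R q].
  elim: i => [|i IH] Hi.
    exists (upd R1 d.+1 0); split; upds => //; first exact: reach_refl.
    by move=> q Hq; upds; exact: F1.
  have [R2 [E2 V2 W2 F2]] := IH (ltnW Hi).
  pose R3 := upd R2 d.+2 (R2 r - R2 d.+1).
  have F3 q : q < d -> R3 q = R q by move=> Hq; rewrite /R3; upds; exact: F2.
  have HR3 q : q < nvars -> R3 q = s.1 q by move=> Hq; rewrite F3 ?HR //; lia.
  have HG3 : ctx_ok [:: (d, v i), (d.+1, i) & G] d.+2 R3.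
    apply: ctx_ok_cons; [lia|by rewrite /R3; upds|].
    apply: ctx_ok_cons; [lia|by rewrite /R3; upds|].
    by apply: ctx_ok_agree HG _ _ => [|q Hq]; [|apply: F3]; lia.
  have [|R4 [E4 V4 F4]] := IHf d (v i) d.+1 i P d.+2 _ R3 s HR3 _ HG3 Cb; first by lia.
  rewrite Hk -/cb in E4.
  exists (upd (upd (upd (upd R4 d 0) d (0 + R4 d.+2)) d.+2 1) d.+1 (R4 d.+1 + 1)).
  split.
  - apply: (@reach_leq _ (i * T + (cost (f' 0 0) s.1 + 5).+2)); first by rewrite /T; lia.
    apply: reach_trans E2 _.
    exec1 C2; exec1 C3.
    rewrite upd_same ifN; last first.
      by rewrite -lt0n subn_gt0 W2 F2 ?HR //; lia.
    apply: reach_trans E4 _.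
    exec1 C4; exec1 C5; exec1 C6; exec1 C7; exec1 C8.
    by upds; apply: reach_refl.
  - by upds; rewrite V4.
  - by upds; rewrite F4 // /R3; upds; lia.
  - by move=> q Hq; upds; rewrite F4 ?F3 //; lia.
have [R2 [E2 V2 W2 F2]] := loop N (leqnn N).
exists (upd R2 d.+2 (R2 r - R2 d.+1)); split; last 2 first.
- by upds; rewrite V2.
- by move=> q Hq; upds; exact: F2.
apply: reach_trans E1 _.
apply: (@reach_leq _ (N * T + 2).+1); first by rewrite /N /T; lia.
exec1 C1; apply: reach_trans E2 _.
exec1 C2; exec1 C3.
rewrite upd_same W2 F2 ?HR; [|lia|lia].
rewrite subnn /=; apply: reach_pc.
by rewrite size_cat /= size_cat /= /la; lia.
Qed.

Lemma pexp_sime G e e' : pexp G e e' -> sime G e e'.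
Proof.
elim=> {G e e'}.
- move=> G c P d l R s HR Hd HG /= /code_at_cons[C1 _].
  exists (upd R d c); split; upds => //; last by move=> r Hr; upds.
  by exec1 C1; rewrite addn1; apply: reach_refl.
- move=> G r Hr P d l R s HR Hd HG /= /code_at_cons[C1 /code_at_cons[C2 _]].
  exists (upd (upd R d 0) d (0 + R r)); split; upds => //; last by move=> q Hq; upds.
    by exec1 C1; exec1 C2; upds; rewrite addn2; apply: reach_refl.
  by rewrite HR.
- move=> G x v Hx P d l R s HR Hd HG /= /code_at_cons[C1 /code_at_cons[C2 _]].
  have [Hxd Hv] := HG _ _ Hx.
  exists (upd (upd R d 0) d (0 + R x)); split; upds => //; last by move=> q Hq; upds.
  by exec1 C1; exec1 C2; upds; rewrite addn2; apply: reach_refl.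
- move=> G a a' b b' _ IHa _ IHb.
  apply: (@sime_bin G EAdd IAdd addn) => // P l R M d x y H.
  by rewrite /step /fetch /= H.
- move=> G a a' b b' _ IHa _ IHb.
  apply: (@sime_bin G ESub ISub subn) => // P l R M d x y H.
  by rewrite /step /fetch /= H.
- move=> G a a' _ IHa P d l R s HR Hd HG /= /code_at_cat[Ca /code_at_cons[C1 _]].
  have [R1 [E1 V1 F1]] := IHa P d l R s HR Hd HG Ca.
  exists (upd R1 d (s.2 (R1 d))); split.
  + apply: reach_trans E1 _; exec1 C1.
    by rewrite size_cat /= addn1 addnS; apply: reach_refl.
  + by rewrite upd_same V1.
  + by move=> r Hr; upds; exact: F1.
- by move=> G a a' b b' c c' _ IHa _ IHb _ IHc; apply: sime_Ite.
- move=> G r a a' f f' Hr _ IHa Hf IHf; apply: sime_Fold => //.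
    by move: Hr; rewrite !inE /nvars; lia.
  move=> R v w.
  by rewrite -(pexp_cost R (Hf 0 v 0 w)) (pexp_cost R (Hf 0 0 0 0)).
Qed.

(** Commands may change program variables, so only the registers from [nvars] to [d] are kept. The
    final state and the time are parameters because the setup and the main loop are not instances of
    [pcmd] and are bounded by hand. *)
Definition simc (G : ctx) (c : cmd) (s s' : state) (T : nat) : Prop :=
  forall P d l R, (forall r, r < nvars -> R r = s.1 r) -> nvars <= d ->
  ctx_ok G d R -> code_at P l (compc c d l) ->
  exists R', [/\ reach P T (Config l R s.2)
                   (Config (l + size (compc c d l)) R' s'.2),
                 (forall r, r < nvars -> R' r = s'.1 r) &
                 forall r, nvars <= r < d -> R' r = R r].

Lemma simc_Asgn G r e e' s : r < nvars -> sime G e e' ->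
  simc G (CAsgn r e) s (sem (CAsgn r e') s) (costc (CAsgn r e') s.1).
Proof.
move=> Hr He P d l R HR Hd HG /= /code_at_cat[Ca /code_at_cons[C1 /code_at_cons[C2 _]]].
have [R1 [E1 V1 F1]] := He P d l R s HR Hd HG Ca.
exists (upd (upd R1 r 0) r (R1 d)); split.
- apply: reach_trans E1 _; exec1 C1; exec1 C2; upds.
  by rewrite size_cat /= addn2 !addnS; apply: reach_refl.
- move=> q Hq; rewrite /upd; case: eqP => // _.
  by rewrite F1 ?HR //; lia.
- by move=> q Hq; upds; apply: F1; lia.
Qed.

Lemma simc_Write G a a' b b' s : sime G a a' -> sime G b b' ->
  simc G (CWrite a b) s (sem (CWrite a' b') s) (costc (CWrite a' b') s.1).
Proof.
move=> IHa IHb P d l R HR Hd HG /= /code_at_cat[Ca /code_at_cat[Cb /code_at_cons[C1 _]]].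
have [R1 [E1 V1 F1]] := IHa P d l R s HR Hd HG Ca.
have HR1 r : r < nvars -> R1 r = s.1 r.
  by move=> Hr; rewrite F1 ?HR //; apply: leq_trans Hd.
have [||R2 [E2 V2 F2]] := IHb P d.+1 _ R1 s HR1 _ _ Cb; first by lia.
  by apply: ctx_ok_agree HG _ _ => [|r Hr]; [|apply: F1]; lia.
exists R2; split.
- apply: reach_trans (reach_trans E1 E2) _.
  exec1 C1; rewrite V2 F2 // V1.
  by rewrite !size_cat /= addn1 !addnS addnA; apply: reach_refl.
- by move=> r Hr; rewrite F2 ?HR1 //; lia.
- by move=> r Hr; rewrite F2 ?F1 //; lia.
Qed.

Lemma simc_Seq G a b s s1 s2 Ta Tb :
  simc G a s s1 Ta -> simc G b s1 s2 Tb -> simc G (CSeq a b) s s2 (Ta + Tb).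
Proof.
move=> IHa IHb P d l R HR Hd HG /= /code_at_cat[Ca Cb].
have [R1 [E1 V1 F1]] := IHa P d l R HR Hd HG Ca.
have [|R2 [E2 V2 F2]] := IHb P d _ R1 V1 Hd _ Cb.
  exact: ctx_ok_agree HG _ F1.
exists R2; split=> //; last by move=> r Hr; rewrite F2 ?F1.
by rewrite size_cat addnA; apply: reach_trans E1 E2.
Qed.

Lemma simc_If G e e' a b s s' T :
  sime G e e' -> simc G (if eval e' s == 0 then b else a) s s' T ->
  simc G (CIf e a b) s s' (cost e' s.1 + (T + 2)).
Proof.
move=> IHe IH P d l R HR Hd HG /=.
move=> /code_at_cat[Ca /code_at_cons[C1 /code_at_cat[Cb /code_at_cons[C2 Cc]]]].
have [R1 [E1 V1 F1]] := IHe P d l R s HR Hd HG Ca.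
have HR1 r : r < nvars -> R1 r = s.1 r.
  by move=> Hr; rewrite F1 ?HR //; apply: leq_trans Hd.
have HG1 : ctx_ok G d R1 by apply: ctx_ok_agree HG _ _ => // r Hr; apply: F1; lia.
move: IH; have [z|z] := boolP (eval e' s == 0) => IH.
  have [R2 [E2 V2 F2]] := IH P d _ R1 HR1 Hd HG1 Cc.
  exists R2; split=> //; last by move=> r Hr; rewrite F2 ?F1 //; lia.
  apply: reach_trans E1 _.
  apply: (@reach_leq _ (T + 0).+1); first by lia.
  exec1 C1; rewrite V1 z.
  by apply: reach_trans E2 _; apply: reach_pc; rewrite size_cat /= size_cat /=; lia.
have [R2 [E2 V2 F2]] := IH P d _ R1 HR1 Hd HG1 Cb.
exists R2; split=> //; last by move=> r Hr; rewrite F2 ?F1 //; lia.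
apply: reach_trans E1 _.
apply: (@reach_leq _ (T + 1).+1); first by lia.
exec1 C1; rewrite V1 (negbTE z).
apply: reach_trans E2 _; exec1 C2.
by apply: reach_pc; rewrite size_cat /= size_cat /=; lia.
Qed.

Lemma simc_leq G c s s' T T' : T <= T' -> simc G c s s' T -> simc G c s s' T'.
Proof.
move=> HT H P d l R HR Hd HG HC; have [R' [E V F]] := H P d l R HR Hd HG HC.
by exists R'; split=> //; apply: reach_leq E.
Qed.

Lemma simc_LetC G e e' f s s' T :
  sime G e e' -> (forall x, simc ((x, eval e' s) :: G) (f x) s s' T) ->
  simc G (CLet e f) s s' (cost e' s.1 + T).
Proof.
move=> IHe IH P d l R HR Hd HG /= /code_at_cat[Ca Cb].
have [R1 [E1 V1 F1]] := IHe P d l R s HR Hd HG Ca.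
have HR1 r : r < nvars -> R1 r = s.1 r.
  by move=> Hr; rewrite F1 ?HR //; apply: leq_trans Hd.
have HG1 : ctx_ok ((d, eval e' s) :: G) d.+1 R1.
  apply: ctx_ok_cons => //; first by lia.
  by apply: ctx_ok_agree HG _ _ => // r Hr; apply: F1; lia.
have [|R2 [E2 V2 F2]] := IH d P d.+1 _ R1 HR1 _ HG1 Cb; first by lia.
exists R2; split=> //; last by move=> r Hr; rewrite F2 ?F1 //; lia.
by rewrite size_cat addnA; apply: reach_trans E1 E2.
Qed.

(** Stated for any sequence of states along which the bound register is constant, so that it also
    covers the main loop, whose bound is not in [loop_regs]. *)
Lemma simc_For G r f (S : nat -> state) N T :
  r < nvars -> (forall i, i <= N -> (S i).1 r = N) ->
  (forall x i, i < N -> simc ((x, i) :: G) (f x) (S i) (S i.+1) T) ->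
  simc G (CFor r f) (S 0) (S N) (3 + N * (T + 5)).
Proof.
move=> Hr HN IH P d l R HR Hd HG /=; set cb := compc _ _ _.
move=> /code_at_cons[C1 /code_at_cons[C2 /code_at_cons[C3 /code_at_cat[Cb]]]].
move=> /code_at_cons[C4 /code_at_cons[C5 /code_at_cons[C6 _]]].
have loop i : i <= N -> exists R', [/\ reach P (i * (T + 5))
     (Config l.+1 (upd R d 0) (S 0).2) (Config l.+1 R' (S i).2), R' d = i,
     forall q, q < nvars -> R' q = (S i).1 q & forall q, nvars <= q < d -> R' q = R q].
  elim: i => [|i IHi] Hi.
    exists (upd R d 0); split; upds => //; first exact: reach_refl.
      by move=> q Hq; upds; exact: HR.
    by move=> q Hq; upds.
  have [R2 [E2 W2 V2 F2]] := IHi (ltnW Hi).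
  pose R3 := upd R2 d.+1 (R2 r - R2 d).
  have HR3 q : q < nvars -> R3 q = (S i).1 q by move=> Hq; rewrite /R3; upds; exact: V2.
  have HG3 : ctx_ok ((d, i) :: G) d.+1 R3.
    apply: ctx_ok_cons; [lia|by rewrite /R3; upds|].
    by apply: ctx_ok_agree HG _ _ => // q Hq; rewrite /R3; upds; exact: F2.
  have [|R4 [E4 V4 F4]] := IH d i Hi P d.+1 _ R3 HR3 _ HG3 Cb; first by lia.
  rewrite -/cb in E4.
  exists (upd (upd R4 d.+1 1) d (R4 d + 1)); split.
  - apply: (@reach_leq _ (i * (T + 5) + (T + 3).+2)); first by lia.
    apply: reach_trans E2 _; exec1 C2; exec1 C3.
    rewrite upd_same ifN; last first.
      by rewrite -lt0n subn_gt0 W2 V2 // HN //; lia.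
    by apply: reach_trans E4 _; exec1 C4; exec1 C5; exec1 C6; upds; apply: reach_refl.
  - by upds; rewrite F4 /R3; [upds|]; lia.
  - by move=> q Hq; upds; exact: V4.
  - by move=> q Hq; upds; rewrite F4 /R3; [upds; exact: F2|]; lia.
have [R2 [E2 W2 V2 F2]] := loop N (leqnn N).
exists (upd R2 d.+1 (R2 r - R2 d)); split.
- apply: (@reach_leq _ (N * (T + 5) + 2).+1); first by lia.
  exec1 C1; apply: reach_trans E2 _; exec1 C2; exec1 C3.
  rewrite upd_same W2 V2 // HN // subnn /=.
  by apply: reach_pc; rewrite size_cat /=; lia.
- by move=> q Hq; upds; exact: V2.
- by move=> q Hq; upds; exact: F2.
Qed.

Lemma sem_frame G c c' s r : pcmd G c c' -> r \notin mut_regs ->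
  (sem c' s).1 r = s.1 r.
Proof.
move=> H Hr; elim: H s => //=.
- by move=> _ q a a' Hq _ s; rewrite upd_other //; apply: contraNneq Hr => ->.
- by move=> _ a a' b b' _ IHa _ IHb s; rewrite IHb IHa.
- by move=> _ e e' a a' b b' _ _ IHa _ IHb s; case: ifP.
- by move=> _ e e' f f' _ _ IH s; exact: (IH 0).
- move=> _ q f f' _ _ IH s; elim: (s.1 q) => //= i <-; exact: (IH 0).
Qed.

Lemma pexp_cost_eq G e e' R R' : pexp G e e' ->
  {in loop_regs, R =1 R'} -> cost e' R = cost e' R'.
Proof.
move=> H HR; elim: H => //=.
- by move=> ? ? ? ? ? _ -> _ ->.
- by move=> ? ? ? ? ? _ -> _ ->.
- by move=> ? ? ? _ ->.
- by move=> ? ? ? ? ? ? ? _ -> _ -> _ ->.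
- by move=> ? r ? ? f f' Hr _ -> _ /(_ 0 0 0 0) ->; rewrite HR.
Qed.

Lemma pcmd_cost_eq G c c' R R' : pcmd G c c' ->
  {in loop_regs, R =1 R'} -> costc c' R = costc c' R'.
Proof.
move=> H HR; elim: H => //=.
- by move=> ? ? ? ? _ /pexp_cost_eq/(_ HR)->.
- by move=> ? ? ? ? ? /pexp_cost_eq/(_ HR)-> /pexp_cost_eq/(_ HR)->.
- by move=> ? ? ? ? ? _ -> _ ->.
- by move=> ? ? ? ? ? ? ? /pexp_cost_eq/(_ HR)-> _ -> _ ->.
- by move=> ? ? ? ? ? /pexp_cost_eq/(_ HR)-> _ /(_ 0 0) ->.
- by move=> ? ? ? ? Hr _ /(_ 0 0) ->; rewrite HR.
Qed.

Lemma loop_regs_mut r : r \in loop_regs -> (r < nvars) && (r \notin mut_regs).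
Proof. by rewrite !inE /nvars; lia. Qed.

(** The cost can be computed from the initial state: no loop register is ever assigned, so all later
    states give the same cost. *)
Lemma pcmd_simc G c c' s : pcmd G c c' -> simc G c s (sem c' s) (costc c' s.1).
Proof.
move=> H; elim: H s => {G c c'}.
- move=> G s P d l R HR Hd HG _; exists R; split=> //.
  by rewrite addn0; apply: reach_refl.
- move=> G r a a' Hr Ha s; apply: simc_Asgn; last exact: pexp_sime.
  by move: Hr; rewrite !inE /nvars; lia.
- by move=> G a a' b b' Ha Hb s; apply: simc_Write; apply: pexp_sime.
- move=> G a a' b b' Ha IHa Hb IHb s /=; apply: simc_Seq (IHa s) _.
  rewrite (pcmd_cost_eq (R' := (sem a' s).1) Hb); first exact: IHb.
  by move=> r /loop_regs_mut/andP[_ /(sem_frame s Ha)].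
- move=> G e e' a a' b b' He Ha IHa Hb IHb s /=.
  apply: simc_If; first exact: pexp_sime.
  case: ifP => _; [apply: simc_leq (IHb s)|apply: simc_leq (IHa s)]; lia.
- move=> G e e' f f' He Hf IH s /=; apply: simc_LetC; first exact: pexp_sime.
  move=> x; rewrite -(pcmd_cost _ (Hf 0 0)) (pcmd_cost _ (Hf 0 (eval e' s))).
  exact: IH.
- move=> G r f f' Hr Hf IH s /=.
  pose S i := iteri i (fun i => sem (f' i)) s.
  have SE q i : q \notin mut_regs -> (S i).1 q = s.1 q.
    move=> Hq; elim: i => //= i <-.
    exact: sem_frame (Hf 0 i) Hq.
  have /andP[Hr1 Hr2] := loop_regs_mut Hr.
  apply: (@simc_For G r f S) => // [i _|x i Hi]; first exact: SE.
  rewrite -(pcmd_cost _ (Hf 0 0)) (pcmd_cost _ (Hf 0 i)).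
  rewrite (pcmd_cost_eq (R' := (S i).1) (Hf 0 i)); first exact: IH.
  by move=> q /loop_regs_mut/andP[_ /SE->].
Qed.

(** * Static costs are polynomial in the loop bounds *)

Definition polyb (T : (nat -> nat) -> nat) : Prop :=
  exists C D, forall R X,
    {in loop_regs, forall r, R r <= X} -> T R <= C * X.+1 ^ D.

Lemma polyb_cst c : polyb (fun _ => c).
Proof. by exists c, 0 => R X _; rewrite muln1. Qed.

(** The base [X.+1] is positive, so both exponents can be raised to their sum. *)
Lemma polyb_add T1 T2 : polyb T1 -> polyb T2 -> polyb (fun R => T1 R + T2 R).
Proof.
move=> [C1 [D1 H1]] [C2 [D2 H2]]; exists (C1 + C2), (D1 + D2) => R X HR.
rewrite mulnDl leq_add //.
  by apply: leq_trans (H1 R X HR) _; rewrite leq_mul // leq_pexp2l // leq_addr.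
by apply: leq_trans (H2 R X HR) _; rewrite leq_mul // leq_pexp2l // leq_addl.
Qed.

Lemma polyb_mul r T : r \in loop_regs -> polyb T -> polyb (fun R => R r * T R).
Proof.
move=> Hr [C [D H]]; exists C, D.+1 => R X HR.
rewrite expnS mulnCA leq_mul //; last exact: H.
by apply: leq_trans (HR r Hr) _.
Qed.

Ltac polyb_tac :=
  repeat (apply: polyb_cst || assumption || apply: polyb_add || (apply: polyb_mul; first done)).

Lemma pexp_cost_poly G e e' : pexp G e e' -> polyb (cost e').
Proof.
elim=> //=; try by move=> *; polyb_tac.
by move=> ? r ? ? f f' ? _ ? _ /(_ 0 0 0 0) ?; polyb_tac.
Qed.

Lemma pcmd_cost_poly G c c' : pcmd G c c' -> polyb (costc c').
Proof.
elim=> //=; try by move=> *; polyb_tac.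
- by move=> ? ? ? ? _ /pexp_cost_poly ?; polyb_tac.
- by move=> ? ? ? ? ? /pexp_cost_poly ? /pexp_cost_poly ?; polyb_tac.
- by move=> ? ? ? ? ? ? ? /pexp_cost_poly ? *; polyb_tac.
- by move=> ? ? ? ? ? /pexp_cost_poly ? _ /(_ 0 0) ?; polyb_tac.
- by move=> ? ? ? ? ? _ /(_ 0 0) ?; polyb_tac.
Qed.

(** * Solutions as labellings *)

Section Labellings.
Variable n : nat.
Implicit Types (a : rel 'I_n) (l : 'I_n -> 'I_n) (C : {set 'I_n}).

Definition fib l C x := [set y in C | l y == l x].

(* Ordered pairs are counted, that is, every deleted edge twice. *)
Definition cross_in l C := \sum_(x in C) \sum_(y in C) (l x != l y).
Definition cross a l := \sum_x \sum_y (a x y && (l x != l y)).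

(** Labels name the cliques left after the deletions, the deleted edges being those between
    different labels. Since [x] and [y] range over all vertices, the one-sided inequality amounts to
    a bound on the absolute difference. *)
Definition sol a (eta k : nat) : Prop :=
  exists l, [/\ forall x y, x != y -> l x = l y -> a x y,
    forall x y, #|fib l setT x| <= #|fib l setT y| + eta & cross a l <= k.*2].

Definition p3free a := forall u v w, a u v -> a v w -> u != w -> a u w.

Definition del a u v : rel 'I_n :=
  [rel x y | a x y && ~~ (((x == u) && (y == v)) || ((x == v) && (y == u)))].

Lemma cross_del a l u v : symmetric a -> u != v -> a u v ->
  cross a l = cross (del a u v) l + (l u != l v).*2.
Proof.
move=> sa uv auv; rewrite /cross.
transitivity (\sum_x \sum_y ((del a u v x y && (l x != l y)) +
   ((((x == u) && (y == v)) + ((x == v) && (y == u))) * (l u != l v)))).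
  apply: eq_bigr => x _; apply: eq_bigr => y _; rewrite /del /=.
  have [/andP[/eqP-> /eqP->]|H1] := boolP ((x == u) && (y == v)).
    by rewrite auv (negbTE uv) /=; case: (l u != l v).
  have [/andP[/eqP-> /eqP->]|H2] := boolP ((x == v) && (y == u)).
    by rewrite sa auv [l v == _]eq_sym; case: (l u != l v).
  by rewrite andbT addn0.
under eq_bigr do rewrite big_split /=.
rewrite big_split /=; congr (_ + _).
under eq_bigr do rewrite -big_distrl /=.
rewrite -big_distrl /=.
suff -> : \sum_x \sum_y (((x == u) && (y == v)) + ((x == v) && (y == u))) = 2.
  by rewrite mul2n.
under eq_bigr do rewrite big_split /=.
have one (p q : 'I_n) : \sum_x \sum_y ((x == p) && (y == q) : nat) = 1.
  rewrite (bigD1 p) //= eqxx (bigD1 q) //= eqxx !big1 // => [y /negbTE->|x /negbTE->] //.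
  by rewrite big1.
by rewrite big_split /= !one.
Qed.

(** Removing in advance an edge that the labelling cuts saves exactly one unit of budget and keeps
    the classes cliques. Conversely, putting an edge back raises the number of cut edges by at most
    one. *)
Lemma sol_branch a eta k u v w : symmetric a -> a u v -> a v w -> ~~ a u w ->
  u != w -> u != v -> v != w ->
  sol a eta k.+1 <-> sol (del a u v) eta k \/ sol (del a v w) eta k.
Proof.
move=> sa auv avw nuw uw uv vw; split.
  move=> [l [Hv Hb Hc]].
  have del_sol p q : p != q -> a p q -> l p != l q -> sol (del a p q) eta k.
    move=> pq apq lpq; exists l; split=> //.
      move=> x y xy lxy; rewrite /del /= Hv //=; apply/negP.
      case/orP=> /andP[/eqP ex /eqP ey]; move: lpq; rewrite -ex -ey lxy eqxx //.
    by move: Hc; rewrite (cross_del l sa pq apq) lpq doubleS -addn2; lia.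
  have [luv|luv] := eqVneq (l u) (l v); last by left; apply: del_sol.
  right; apply: del_sol => //; rewrite -luv; apply: contra nuw => /eqP.
  exact: Hv.
have undel p q : p != q -> a p q -> sol (del a p q) eta k -> sol a eta k.+1.
  move=> pq apq [l [Hv Hb Hc]]; exists l; split=> //.
    by move=> x y xy /(Hv _ _ xy); rewrite /del /= => /andP[].
  by rewrite (cross_del l sa pq apq); case: (l p != l q) => /=; lia.
by case; apply: undel.
Qed.

(** With nothing to cut, labels are constant along edges, hence along paths. Thus a solvable node
    with exhausted budget is already a cluster graph. *)
Lemma sol0_p3free a eta : irreflexive a -> sol a eta 0 -> p3free a.
Proof.
move=> ia [l [Hv _ Hc]] u v w auv avw uw.
have same x y : a x y -> l x = l y.
  move=> axy; apply/eqP; apply: contraTT Hc => lxy; rewrite -ltnNge.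
  by rewrite /cross (bigD1 x) //= (bigD1 y) //= axy lxy.
by apply: Hv => //; rewrite (same _ _ auv); apply: same.
Qed.

Lemma cross_bound a l : cross a l <= n * n.
Proof.
apply: leq_trans (_ : \sum_(x < n) \sum_(y < n) 1 <= _).
  by apply: leq_sum => x _; apply: leq_sum => y _; exact: leq_b1.
by rewrite !sum_nat_const !card_ord muln1.
Qed.

Lemma sol_minn a eta k : sol a eta k <-> sol a eta (minn k (n * n)).
Proof.
split=> [] [l [Hv Hb Hc]]; exists l; split=> //.
  by have := cross_bound a l; lia.
by apply: leq_trans Hc _; rewrite leq_double geq_minl.
Qed.

(** * Splitting cliques *)

(** The value [s = 0] is tried as well, so positivity is a separate condition; it makes the
    recursion on the clique size decrease. *)
Definition part_ok (s eta p : nat) := (0 < p) && (s <= p <= s + eta).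

(* [g m] is twice the least number of edges to delete from a clique on [m]
   vertices to split it into parts of sizes between [s] and [s + eta], capped
   at [INF]. *)
Definition split_table (s eta INF : nat) (g : nat -> nat) : Prop :=
  g 0 = 0 /\ forall m, 0 < m <= n ->
   (forall p, p <= m -> part_ok s eta p -> g m <= g (m - p) + (p * (m - p)).*2) /\
   (INF <= g m \/ exists2 p, p <= m & part_ok s eta p /\ g m = g (m - p) + (p * (m - p)).*2).

Lemma card_le C : #|C| <= n.
Proof. by have := max_card (mem C); rewrite card_ord. Qed.

(** Source of the recursion: separating [P] cuts every pair between [P] and the rest, in both
    orders, and nothing inside [P]. *)
Lemma cross_inD l C (P : {set 'I_n}) : P \subset C ->
  (forall x y, x \in P -> y \in P -> l x = l y) ->
  (forall x y, x \in P -> y \in C :\: P -> l x != l y) ->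
  cross_in l C = cross_in l (C :\: P) + (#|P| * (#|C| - #|P|)).*2.
Proof.
move=> PC HP HCP.
have split_sum (f : 'I_n -> nat) : \sum_(x in C) f x = \sum_(x in P) f x + \sum_(x in C :\: P) f x.
  rewrite (bigID (mem P)) /=; congr (_ + _); apply: eq_bigl => x; rewrite ?inE.
    by case: (boolP (x \in P)) => [/(subsetP PC)->|]; rewrite ?andbF.
  by rewrite andbC.
have cD : #|C :\: P| = #|C| - #|P| by rewrite cardsD (setIidPr PC).
rewrite /cross_in split_sum.
under eq_bigr do rewrite split_sum.
under [X in _ + X]eq_bigr do rewrite split_sum.
rewrite !big_split /=.
have E0 : \sum_(x in P) \sum_(y in P) (l x != l y : nat) = 0.
  by apply: big1 => x Hx; apply: big1 => y Hy; rewrite (HP x y) ?eqxx.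
have E1 : \sum_(x in P) \sum_(y in C :\: P) (l x != l y : nat) = #|P| * (#|C| - #|P|).
  rewrite -cD -sum_nat_const; apply: eq_bigr => x Hx.
  by rewrite -sum1_card; apply: eq_bigr => y Hy; rewrite HCP.
have E2 : \sum_(x in C :\: P) \sum_(y in P) (l x != l y : nat) = #|P| * (#|C| - #|P|).
  rewrite exchange_big /= -E1; apply: eq_bigr => x _; apply: eq_bigr => y _.
  by rewrite eq_sym.
by rewrite E0 E1 E2 add0n -addnn addnA addnC.
Qed.

(** One label class is stripped off at a time, the table inequality being used with its size. The
    hypothesis that [C] is a union of whole classes survives this. *)
Lemma split_lower s eta INF g l : split_table s eta INF g ->
  forall C, (forall x, x \in C -> fib l setT x \subset C /\ part_ok s eta #|fib l setT x|) ->
  g #|C| <= cross_in l C.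
Proof.
move=> [g0 Hg] C; move: {2}#|C| (leqnn #|C|) => m; elim: m C => [|m IH] C Hm HC.
  by move: Hm; rewrite leqn0 => /eqP->; rewrite g0.
have [->|[x Hx]] := set_0Vmem C; first by rewrite cards0 g0.
have [HP Hok] := HC x Hx; set P := fib l setT x in HP Hok.
have Px : x \in P by rewrite !inE eqxx.
have C0 : 0 < #|C| <= n.
  by rewrite card_le andbT; apply/card_gt0P; exists x.
have [H1 _] := Hg _ C0.
rewrite (@cross_inD l C P) //.
- apply: leq_trans (H1 #|P| (subset_leq_card HP) Hok) _; rewrite leq_add2r.
  have cD : #|C :\: P| = #|C| - #|P| by rewrite cardsD (setIidPr HP).
  rewrite -cD; apply: IH; first by rewrite cD; case/andP: Hok => H _; lia.
  move=> y; rewrite inE => /andP[yP yC]; have [H2 H3] := HC y yC; split=> //.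
  apply/subsetP=> z Hz; rewrite inE (subsetP H2) // andbT.
  by apply: contra yP; move: Hz; rewrite !inE /= => /eqP->.
- by move=> y z; rewrite !inE /= => /eqP-> /eqP->.
- move=> y z; rewrite !inE /= => /eqP-> /andP[]; by rewrite eq_sym.
Qed.

(** Follows the minimising choices of the table, which stay below [INF] since the value drops to
    that of the remainder. Any [p] vertices can form the new part; they are labelled by one of their
    own vertices, which cannot be a label of the remainder because labels stay inside the set they
    label. *)
Lemma split_upper s eta INF g : split_table s eta INF g ->
  forall C, g #|C| < INF -> exists l,
    [/\ forall x, x \in C -> l x \in C,
        forall x, x \in C -> part_ok s eta #|fib l C x| &
        cross_in l C = g #|C|].
Proof.
move=> [g0 Hg] C; move: {2}#|C| (leqnn #|C|) => m; elim: m C => [|m IH] C Hm HC.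
  move: Hm; rewrite leqn0 cards_eq0 => /eqP->; exists id; split=> [x|x|]; rewrite ?inE //.
  by rewrite cards0 g0 /cross_in big_set0.
have [->|[x0 Hx0]] := set_0Vmem C.
  exists id; split=> [x|x|]; rewrite ?inE //.
  by rewrite cards0 g0 /cross_in big_set0.
have C0 : 0 < #|C| <= n.
  by rewrite card_le andbT; apply/card_gt0P; exists x0.
have [_ [Hi|[p Hp [Hok Ep]]]] := Hg _ C0; first by lia.
pose P := [set x in take p (enum C)].
have PC : P \subset C by apply/subsetP=> x; rewrite inE => /mem_take; rewrite mem_enum.
have cP : #|P| = p.
  rewrite cardsE (card_uniqP _) ?take_uniq ?enum_uniq // size_take -cardE.
  by case: ltngtP Hp => // ->.
have cD : #|C :\: P| = #|C| - p by rewrite cardsD (setIidPr PC) cP.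
have p0 : 0 < p by case/andP: Hok.
have Hm' : #|C :\: P| <= m by rewrite cD; lia.
have HC' : g #|C :\: P| < INF.
  by rewrite cD; apply: leq_ltn_trans HC; rewrite Ep leq_addr.
have [l [Hl Hf Hx]] := IH _ Hm' HC'.
have [y0 Hy0] : exists y, y \in P by apply/card_gt0P; rewrite cP.
pose l' x := if x \in P then y0 else l x.
have l'P x : x \in P -> l' x = y0 by rewrite /l' => ->.
have l'D x : x \in C :\: P -> l' x \in C :\: P.
  by move=> Hx'; move: (Hx'); rewrite in_setD => /andP[/negbTE H _]; rewrite /l' H Hl.
have Hne x y : x \in P -> y \in C :\: P -> l' x != l' y.
  move=> /l'P-> /l'D H; apply: contraTneq Hy0 => ->.
  by move: H; rewrite in_setD => /andP[].
exists l'; split.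
- move=> x xC; have [xP|xP] := boolP (x \in P); first by rewrite l'P // (subsetP PC).
  by have := l'D x; rewrite !in_setD xP xC => /(_ isT)/andP[].
- move=> x xC; have [xP|xP] := boolP (x \in P).
    suff -> : fib l' C x = P by rewrite cP.
    apply/setP=> y; rewrite in_set; have [yP|yP] := boolP (y \in P).
      by rewrite (subsetP PC) // !l'P ?eqxx.
    have [yC|//] := boolP (y \in C).
    by rewrite eq_sym; apply/negbTE/Hne => //; rewrite in_setD yP.
  have xD : x \in C :\: P by rewrite in_setD xP.
  suff -> : fib l' C x = fib l (C :\: P) x by apply: Hf.
  apply/setP=> y; rewrite ![y \in fib _ _ _]in_set in_setD; have [yP|yP] := boolP (y \in P) => /=.
    by apply/negbTE; rewrite negb_and (negbTE (Hne _ _ yP xD)) orbT.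
  by rewrite /l' (negbTE yP) (negbTE xP).
- rewrite (@cross_inD l' C P) //; last by move=> x y /l'P-> /l'P->.
  rewrite Ep cP -cD -Hx; congr (_ + _).
  apply: eq_bigr => x; rewrite in_setD => /andP[/negbTE xP _].
  by apply: eq_bigr => y; rewrite in_setD => /andP[/negbTE yP _]; rewrite /l' xP yP.
Qed.

(** * Balancing a cluster graph *)

(** In a cluster graph exactly one vertex of each clique qualifies, so a sum over such vertices is a
    sum over cliques. *)
Definition least a (v : 'I_n) := [forall u : 'I_n, (u < v) ==> ~~ a u v].

Section Cluster.
Variable a : rel 'I_n.
Hypotheses (sa : symmetric a) (ia : irreflexive a) (pa : p3free a).

(** Closed neighbourhoods; P3-freeness makes them equivalence classes, that is, the cliques. *)
Let cl (x : 'I_n) : {set 'I_n} := [set y | (x == y) || a x y].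

Let cl_refl x : x \in cl x.
Proof. by rewrite inE eqxx. Qed.

Let cl_sym x y : (y \in cl x) = (x \in cl y).
Proof. by rewrite !inE eq_sym sa. Qed.

Let cl_trans x y z : y \in cl x -> z \in cl y -> z \in cl x.
Proof.
rewrite !inE => /orP[/eqP->|axy] // /orP[/eqP<-|ayz]; first by rewrite axy orbT.
by have [//|xz] := eqVneq x z; rewrite (pa axy ayz xz).
Qed.

Let cl_eq x y : y \in cl x -> cl y = cl x.
Proof.
move=> H; apply/setP=> z; apply/idP/idP; first exact: cl_trans.
by apply: cl_trans; rewrite cl_sym.
Qed.

Lemma card_cl x : #|cl x| = (\sum_y a x y).+1.
Proof.
have -> : cl x = x |: [set y | a x y] by apply/setP=> y; rewrite !inE eq_sym.
rewrite cardsU1 inE ia add1n -sum1_card big_mkcond /=; congr _.+1.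
by apply: eq_bigr => y _; rewrite inE; case: (a x y).
Qed.

Let rep x : 'I_n := [arg min_(y < x in cl x) y].

Let rep_cl x : rep x \in cl x.
Proof. by rewrite /rep; case: arg_minnP. Qed.

Let rep_min x y : y \in cl x -> rep x <= y.
Proof. by rewrite /rep; case: arg_minnP => // z _ H /H. Qed.

Let rep_least x : least a (rep x).
Proof.
apply/forallP=> u; apply/implyP=> Hu; apply: contraTN Hu => au; rewrite -leqNgt.
by apply: rep_min; apply: cl_trans (rep_cl x) _; rewrite inE sa au orbT.
Qed.

Let least_rep v : least a v -> rep v = v.
Proof.
move=> /forallP H; apply/val_inj/eqP; rewrite eqn_leq rep_min //= leqNgt.
have := H (rep v); apply: contraTN => Hlt.
rewrite negb_imply Hlt negbK; have := rep_cl v; rewrite inE sa => /orP[|//].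
by move/eqP=> E; move: Hlt; rewrite -E ltnn.
Qed.

Let rep_eq v x : least a v -> (rep x == v) = (x \in cl v).
Proof.
move=> Hv; apply/eqP/idP => [<-|Hx]; first by rewrite cl_sym rep_cl.
rewrite -[RHS](least_rep Hv); apply/val_inj/eqP; rewrite eqn_leq !rep_min //=.
  by rewrite -(cl_eq Hx) rep_cl.
by rewrite (cl_eq Hx) rep_cl.
Qed.

(** Distinct cliques have no edges between them, and inside a clique every pair with different
    labels is an edge. *)
Lemma cross_components l : (forall x y, x != y -> l x = l y -> a x y) ->
  cross a l = \sum_(v | least a v) cross_in l (cl v).
Proof.
move=> Hv; rewrite /cross (partition_big rep (least a)) //=.
apply: eq_bigr => v lv; rewrite /cross_in.
under eq_bigl do rewrite rep_eq //.
apply: eq_bigr => x xv; rewrite [RHS]big_mkcond /=; apply: eq_bigr => y _.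
rewrite -(cl_eq xv) inE.
have [->|xy] := eqVneq x y; first by rewrite eqxx andbF.
by case: (a x y).
Qed.

(** From a solution, [s] is the size of a smallest class; every class lies inside one clique, so the
    table bounds the cost clique by clique. Conversely, optimal splittings of the cliques are glued;
    their labels do not collide because each clique is labelled by its own vertices. The bound on
    [b] keeps each table entry in the sum below the cap. *)
Lemma sol_cluster eta b (INF : nat) (g : nat -> nat -> nat) :
  b.*2 < INF -> (forall s, s <= n -> split_table s eta INF (g s)) ->
  sol a eta b <-> exists2 s, s <= n &
     \sum_(v | least a v) g s (\sum_y a v y).+1 <= b.*2.
Proof.
move=> Hb Hg; split.
  move=> [l [Hv Hbal Hc]].
  have [n0|n0] := posnP n.
    exists 0 => //; rewrite big1 // => v; by have := ltn_ord v; rewrite {2}n0.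
  pose x0 : 'I_n := Ordinal n0.
  pose m := [arg min_(y < x0) #|fib l setT y|].
  have Hm y : #|fib l setT m| <= #|fib l setT y|.
    by rewrite /m; case: arg_minnP => // z _; apply.
  have sn : #|fib l setT m| <= n by exact: card_le.
  exists #|fib l setT m| => //; apply: leq_trans Hc.
  rewrite cross_components //; apply: leq_sum => v _; rewrite -card_cl.
  apply: (split_lower (Hg _ sn)) => x xv; split.
    apply/subsetP=> y; rewrite !inE /= => /eqP lyx; rewrite -[_ || _](in_set (fun y => (v == y) || a v y)).
    apply: cl_trans xv _; rewrite inE; have [//|xy] := eqVneq x y.
    by rewrite Hv.
  rewrite /part_ok Hm Hbal !andbT; apply/card_gt0P; exists x.
  by rewrite !inE eqxx.
move=> [s sn Hs]; have Hgs := Hg s sn.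
have ex v : exists l : {ffun 'I_n -> 'I_n}, least a v ->
   [/\ forall x, x \in cl v -> l x \in cl v,
       forall x, x \in cl v -> part_ok s eta #|fib l (cl v) x| &
       cross_in l (cl v) = g s #|cl v|].
  have [lv|_] := boolP (least a v); last by exists (finfun id).
  have [|l [H1 H2 H3]] := split_upper Hgs (C := cl v).
    apply: leq_ltn_trans Hb; apply: leq_trans Hs.
    by rewrite (bigD1 v) //= card_cl leq_addr.
  have El x : finfun l x = l x by rewrite ffunE.
  exists (finfun l) => _; split=> [x|x|].
  - by rewrite El; apply: H1.
  - move=> Hx; have := H2 x Hx; congr (part_ok _ _ #|pred_of_set _|).
    by apply/setP=> y; rewrite !inE !El.
  - by rewrite -H3; apply: eq_bigr => x _; apply: eq_bigr => y _; rewrite !El.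
(* One labelling per vertex is chosen; only those at clique minima are used, through [rep]. *)
have {ex} [L HL] := fin_all_exists ex.
pose l x := L (rep x) x.
have lE v x : least a v -> x \in cl v -> l x = L v x.
  by move=> lv; rewrite -rep_eq // /l => /eqP->.
have xrep x : x \in cl (rep x) by rewrite cl_sym rep_cl.
have lcl x : l x \in cl x.
  have [H _ _] := HL _ (rep_least x).
  by rewrite -(cl_eq (rep_cl x)); apply: H.
have same x y : l x = l y -> y \in cl x.
  move=> E; apply: cl_trans (lcl x) _; rewrite E cl_sym; exact: lcl.
have Hval x y : x != y -> l x = l y -> a x y.
  by move=> xy /same; rewrite inE (negbTE xy).
exists l; split=> //.
  have sz x : part_ok s eta #|fib l setT x|.
    have lr := rep_least x; have [_ H _] := HL _ lr.
    have := H x (xrep x); congr (part_ok _ _ #|pred_of_set _|).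
    apply/setP=> y; rewrite !inE /= -[_ || _](in_set (fun y => (rep x == y) || a (rep x) y)) -/(cl (rep x)).
    have [yr|yr] /= := boolP (y \in cl (rep x)).
      by rewrite (lE _ _ lr yr) (lE _ _ lr (xrep x)).
    apply/esym/negbTE; apply: contra yr => /eqP E.
    by rewrite (cl_eq (rep_cl x)); apply: same.
  move=> x y; have /and3P[_ _ H1] := sz x; have /and3P[_ H2 _] := sz y; lia.
rewrite cross_components //; apply: leq_trans Hs; apply: leq_sum => v lv.
have [_ _ H] := HL _ lv.
rewrite -card_cl -H; apply: leq_sum => x xv; apply: leq_sum => y yv.
by rewrite (lE v x) // (lE v y).
Qed.

End Cluster.
End Labellings.

(** * Deleted edge sets versus labellings *)

Lemma adj_sym (T : finType) (G : sgraph T) : symmetric (adj G).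
Proof. by move=> x y; rewrite /adj /= setUC. Qed.

Lemma adj_irr (T : finType) (G : sgraph T) : irreflexive (adj G).
Proof.
move=> x; apply/negP; rewrite /adj /= setUid => /edges_card2.
by rewrite cards1.
Qed.

Lemma crossE n (a : rel 'I_n) l :
  cross a l = #|[set p : 'I_n * 'I_n | a p.1 p.2 && (l p.1 != l p.2)]|.
Proof.
rewrite /cross pair_big /= -sum1_card [RHS]big_mkcond /=.
by apply: eq_bigr => p _; rewrite inE; case: (_ && _).
Qed.

Lemma set2_inj n (x y x' y' : 'I_n) : [set x; y] = [set x'; y'] ->
  (x < y) = (x' < y') -> x != y -> (x, y) = (x', y').
Proof.
move=> E H xy.
have: x \in [set x'; y'] by rewrite -E !inE eqxx.
have: y \in [set x'; y'] by rewrite -E !inE eqxx orbT.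
rewrite !inE => /orP[] /eqP ? /orP[] /eqP ?; subst => //.
- by rewrite eqxx in xy.
- by move: H xy; rewrite -(inj_eq val_inj) /=; lia.
- by rewrite eqxx in xy.
Qed.

(** A deletion set yields the labelling by component roots; a labelling yields the set of edges it
    cuts. In the latter case the components are exactly the label classes, since every class is a
    clique. *)
Lemma bcd_sol n (G : sgraph 'I_n) k eta :
  balanced_cluster_deletion G k eta <-> sol (adj G) eta k.
Proof.
split.
  move=> [F [FG Fk Hcl Hbal]]; set G' := del_edges G F in Hcl Hbal.
  have cs : connect_sym (adj G') by apply: sym_connect_sym; exact: adj_sym.
  have comp_in x : component G' x \in components G' by apply: imset_f.
  pose l := root (adj G').
  have lE x y : (l x == l y) = connect (adj G') x y by rewrite /l root_connect.
  have fibE x : fib l setT x = component G' x.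
    by apply/setP=> y; rewrite !inE /= lE cs.
  exists l; split.
  - move=> x y xy /eqP; rewrite lE => Hxy.
    have : adj G' x y by apply: (Hcl _ (comp_in x)); rewrite ?inE ?connect0.
    by rewrite /adj /= inE => /andP[].
  - by move=> x y; rewrite !fibE; have := Hbal _ _ (comp_in x) (comp_in y); lia.
  - rewrite crossE; set S := [set p | _].
    (* An ordered pair is recovered from its edge and its orientation, so at most [2 * #|F|] pairs
       are cut. *)
    pose h (p : 'I_n * 'I_n) := ([set p.1; p.2], p.1 < p.2).
    have hinj : {in S &, injective h}.
      move=> [x y] [x' y'] /=; rewrite !inE /= => /andP[xy _] _ [E1 E2].
      by apply: set2_inj => //; apply: contraTneq xy => ->; rewrite adj_irr.
    rewrite -(card_in_imset hinj).
    apply: leq_trans (_ : #|setX F [set: bool]| <= _); last first.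
      by rewrite cardsX cardsT card_bool muln2 leq_double.
    apply/subset_leq_card/subsetP=> _ /imsetP[[x y] + ->]; rewrite !inE /= andbT.
    move=> /andP[xy]; rewrite lE; apply: contraR => nF.
    by apply: connect1; rewrite /adj /= inE nF.
move=> [l [Hv Hb Hc]].
pose S := [set p : 'I_n * 'I_n | (p.1 < p.2) && (adj G p.1 p.2 && (l p.1 != l p.2))].
pose F := [set [set p.1; p.2] | p in S].
have FE x y : adj G x y -> ([set x; y] \in F) = (l x != l y).
  move=> axy; apply/imsetP/idP.
    move=> [[x' y']]; rewrite inE /= => /and3P[_ _ +] E.
    have: x \in [set x'; y'] by rewrite -E !inE eqxx.
    have: y \in [set x'; y'] by rewrite -E !inE eqxx orbT.
    have xy : x != y by apply: contraTneq axy => ->; rewrite adj_irr.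
    rewrite !inE => /orP[] /eqP ? /orP[] /eqP ?; subst => //; rewrite ?eqxx // in xy *.
    by rewrite eq_sym.
  move=> lxy; case: (ltngtP x y) => [xy|xy|/val_inj E].
  - by exists (x, y) => //; rewrite inE /= xy axy.
  - by exists (y, x); [rewrite inE /= xy adj_sym axy eq_sym | rewrite setUC].
  - by rewrite E eqxx in lxy.
set G' := del_edges G F.
have adjE x y : adj G' x y = adj G x y && (l x == l y).
  rewrite [adj G' x y]/adj /= inE andbC -[_ \in edges G]/(adj G x y).
  by have [/FE->|//] := boolP (adj G x y); rewrite negbK.
have conE x y : connect (adj G') x y = (l x == l y).
  apply/idP/idP.
    case/connectP=> p; elim: p x => [|z p IH] x /=; first by move=> _ ->.
    by rewrite adjE => /andP[/andP[_ /eqP->]] /IH H /H.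
  have [->|xy E] := eqVneq x y; first by rewrite connect0.
  by apply: connect1; rewrite adjE E Hv //; apply/eqP.
have compE x : component G' x = fib l setT x.
  by apply/setP=> y; rewrite !inE conE eq_sym.
exists F; split.
- by apply/subsetP=> _ /imsetP[p + ->]; rewrite inE => /and3P[_ ? _].
- apply: leq_trans (leq_imset_card _ _) _; rewrite -leq_double; apply: leq_trans Hc.
  rewrite crossE; set S' := [set p | _].
  (* [S] and its mirror image are disjoint sets of cut pairs, whence the factor 2. *)
  pose sw (p : 'I_n * 'I_n) := (p.2, p.1).
  have swI : injective sw by move=> [? ?] [? ?] [-> ->].
  rewrite -addnn -{2}(card_imset _ swI) -cardsUI.
  have -> : S :&: (sw @: S) = set0.
    apply/setP=> p; rewrite !inE; apply/negP=> /andP[/and3P[H _ _]] /imsetP[q].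
    by rewrite inE => /and3P[H' _ _] E; move: H H'; rewrite E /=; lia.
  rewrite cards0 addn0; apply/subset_leq_card/subsetP=> p; rewrite !inE.
  case/orP=> [/and3P[_ -> ->] //|/imsetP[q]]; rewrite inE => /and3P[_ H1 H2] -> /=.
  by rewrite adj_sym H1 eq_sym.
- move=> _ /imsetP[x _ ->] y z; rewrite compE !inE /= => /eqP Ey /eqP Ez yz.
  by rewrite adjE Ey Ez eqxx Hv // Ey.
- move=> _ _ /imsetP[x _ ->] /imsetP[y _ ->]; rewrite !compE.
  by have := Hb x y; have := Hb y x; lia.
Qed.

(** * The program *)

Definition esum r (f : nat -> exp) :=
  EFold r (ECst 0) (fun acc i => EAdd (EVar acc) (f i)).
(** The machine cannot multiply; a product with a loop register is a repeated sum. *)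
Definition emul r e := esum r (fun _ => e).
Definition eand a b := EIte a b (ECst 0).
Definition enot a := ESub (ECst 1) a.
Definition ele a b := enot (ESub a b).
Definition emin a b := EIte (ESub a b) b a.
(** Yields 0 also when nothing matches, so the result has to be tested again, as [branchc] does. *)
Definition elast (p : nat -> exp) :=
  EFold 0 (ECst 0) (fun acc i => EIte (p i) (EVar i) (EVar acc)).

(* Registers: 0, 1, 2 hold the input n, k, eta; 3 holds n^2; 4 holds
   K := min(k, n^2); 5 holds 2^K; 6 holds n+1; 10 holds the branching bits still
   to be read; 11 the remaining budget; 12 the answer. The working copy of the
   adjacency matrix starts at address n^2, the table of splitting costs at 2n^2. *)
Definition eaddr u v := EAdd (EReg 3) (EAdd (emul 0 (EVar u)) (EVar v)).
Definition eadj u v := ERead (eaddr u v).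
(** Subtraction being truncated, the final sum is nonzero exactly when [u] and [w] differ. *)
Definition ep3 u v w :=
  eand (eadj u v) (eand (eadj v w) (eand (enot (eadj u w))
    (EAdd (ESub (EVar u) (EVar w)) (ESub (EVar w) (EVar u))))).
Definition ep3u u v := esum 0 (ep3 u v).
Definition ep3s u := esum 0 (ep3u u).

(** Evaluated after register 10 has been doubled: nonzero exactly when its content reaches [2^K],
    that is, when the next branching bit is 1. *)
Definition bit := ESub (EReg 10) (ESub (EReg 5) (ECst 1)).

Definition del_edge u v :=
  CSeq (CWrite (eaddr u v) (ECst 0)) (CWrite (eaddr v u) (ECst 0)).

Definition branchc u v w :=
  CSeq (CAsgn 10 (EAdd (EReg 10) (EReg 10)))
  (CSeq (CIf (ep3 u v w)
           (CSeq (CAsgn 11 (ESub (EReg 11) (ECst 1)))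
                 (CIf bit (del_edge u v) (del_edge v w)))
           CSkip)
        (CAsgn 10 (EIte bit (ESub (EReg 10) (EReg 5)) (EReg 10)))).

Definition stepc :=
  CLet (elast ep3s) (fun u => CLet (elast (ep3u u)) (fun v =>
  CLet (elast (ep3 u v)) (branchc u v))).

Definition etab i := EAdd (EAdd (EReg 3) (EReg 3)) i.
(** [2n^2 + 1] exceeds twice any remaining budget, as the budget is at most [K <= n^2]. *)
Definition einf := EAdd (EAdd (EReg 3) (EReg 3)) (ECst 1).
Definition epart s m p :=
  eand (EVar p) (eand (ele (EVar s) (EVar p))
    (eand (ele (EVar p) (EAdd (EVar s) (EReg 2))) (ele (EVar p) (EVar m)))).
(** The sum runs over [n+1] rounds, of which those with [i < p] contribute [2 (m - p)] each. *)
Definition esplit m p :=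
  EAdd (ERead (etab (ESub (EVar m) (EVar p))))
      (esum 6 (fun i => EIte (ESub (EVar p) (EVar i))
        (EAdd (ESub (EVar m) (EVar p)) (ESub (EVar m) (EVar p))) (ECst 0))).
Definition ebest s m :=
  EFold 6 einf (fun acc p =>
    EIte (epart s m p) (emin (EVar acc) (esplit m p)) (EVar acc)).
Definition tablec s :=
  CFor 6 (fun m => CWrite (etab (EVar m)) (EIte (EVar m) (ebest s m) (ECst 0))).

Definition etotal :=
  esum 0 (fun v => EIte (esum 0 (fun u => eand (ESub (EVar v) (EVar u)) (eadj u v)))
    (ECst 0)
    (ERead (etab (EAdd (ECst 1) (esum 0 (fun y => eand (eadj v y) (ECst 1))))))).
(** A path may end in a graph that still has an induced P3, hence the first test. Register 12 is set
    but never cleared, so it accumulates the disjunction over all [s] and all paths. *)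
Definition checkc :=
  CIf (eand (enot (esum 0 ep3s)) (ele etotal (EAdd (EReg 11) (EReg 11))))
    (CAsgn 12 (ECst 1)) CSkip.

Definition copyc := CFor 3 (fun i => CWrite (EAdd (EReg 3) (EVar i)) (ERead (EVar i))).

Definition leafc := CFor 6 (fun s => CSeq (tablec s) checkc).
Definition bodyc x :=
  CSeq copyc (CSeq (CAsgn 10 (EVar x)) (CSeq (CAsgn 11 (EReg 4))
    (CSeq (CFor 4 (fun _ => stepc)) leafc))).

Ltac pexp_tac := repeat first
  [ progress intros
  | apply: pCst | apply: pReg; done | apply: pAdd | apply: pSub | apply: pRead
  | apply: pIte | apply: pFold; first done
  | apply: pVar; rewrite /=; tauto
  | apply: pSkip | apply: pAsgn; first done | apply: pWrite | apply: pSeq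
  | apply: pIf | apply: pLetC | apply: pFor; first done ].

Lemma pcmd_step G : pcmd G stepc stepc.
Proof. by rewrite /stepc; pexp_tac. Qed.

Lemma pcmd_check G : pcmd G checkc checkc.
Proof. by rewrite /checkc; pexp_tac. Qed.

Lemma pcmd_table G x s : pcmd ((x, s) :: G) (tablec x) (tablec s).
Proof. by rewrite /tablec; pexp_tac. Qed.

Lemma pcmd_leaf G : pcmd G leafc leafc.
Proof.
by apply: pFor => // x v; apply: pSeq; [apply: pcmd_table|apply: pcmd_check].
Qed.

Lemma pcmd_body G x v : pcmd ((x, v) :: G) (bodyc x) (bodyc v).
Proof.
apply: pSeq; first by rewrite /copyc; pexp_tac.
apply: pSeq; first by pexp_tac.
apply: pSeq; first by pexp_tac.
apply: pSeq; last exact: pcmd_leaf.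
by apply: pFor => // y w; apply: pcmd_step.
Qed.

(** * Semantics of the fragments of the program *)

Definition regs_ok n eta K (R : nat -> nat) : Prop :=
  [/\ R 0 = n, R 2 = eta, R 3 = n * n, R 4 = K & R 5 = 2 ^ K /\ R 6 = n.+1].

Lemma regs_ok_sem n eta K G c c' s : pcmd G c c' ->
  regs_ok n eta K s.1 -> regs_ok n eta K (sem c' s).1.
Proof.
move=> Hc; rewrite /regs_ok.
by rewrite !(sem_frame s Hc).
Qed.

Lemma eval_esum r f s : eval (esum r f) s = \sum_(i < s.1 r) eval (f i) s.
Proof. by rewrite /=; elim: (s.1 r) => [|m IH]; rewrite ?big_ord0 // big_ord_recr /= IH. Qed.

Lemma esum_neq0 r n f s (p : pred nat) : s.1 r = n ->
  (forall i, i < n -> (eval (f i) s != 0) = p i) ->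
  (eval (esum r f) s != 0) = [exists i : 'I_n, p i].
Proof.
move=> Hn Hp; rewrite eval_esum Hn sum_nat_eq0 negb_forall.
by apply: eq_existsb => i /=; rewrite Hp.
Qed.

Lemma eval_eaddr n u v s : s.1 0 = n -> s.1 3 = n * n ->
  eval (eaddr u v) s = n * n + (n * u + v).
Proof.
move=> H0 H3.
have -> : eval (eaddr u v) s = s.1 3 + (eval (emul 0 (EVar u)) s + v) by [].
by rewrite eval_esum H3 H0 /= sum_nat_const card_ord.
Qed.

Definition madj n (M : nat -> nat) : rel nat :=
  fun u v => [&& u < n, v < n & M (n * n + (n * u + v)) != 0].

Definition p3 (A : rel nat) u v w := [&& A u v, A v w, ~~ A u w & u != w].

Lemma eval_ep3 n u v w s : s.1 0 = n -> s.1 3 = n * n ->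
  u < n -> v < n -> w < n ->
  (eval (ep3 u v w) s != 0) = p3 (madj n s.2) u v w.
Proof.
move=> H0 H3 Hu Hv Hw; rewrite /p3 /madj Hu Hv Hw /=.
have adjE x y : eval (eadj x y) s = s.2 (n * n + (n * x + y)).
  by rewrite -(eval_eaddr x y H0 H3).
rewrite -!adjE -[LHS]/((if eval (eadj u v) s == 0 then 0
  else if eval (eadj v w) s == 0 then 0
  else if 1 - eval (eadj u w) s == 0 then 0 else (u - w) + (w - u)) != 0).
move: (eval (eadj u v) s) (eval (eadj v w) s) (eval (eadj u w) s) => a b c.
by case: a => [|a] //; case: b => [|b] //; case: c => [|c] //=; lia.
Qed.

Definition last_such n (p : pred nat) :=
  iteri n (fun i acc => if p i then i else acc) 0.

Lemma eval_elast n f s (p : pred nat) : s.1 0 = n ->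
  (forall i, i < n -> (eval (f i) s != 0) = p i) ->
  eval (elast f) s = last_such n p.
Proof.
move=> H0 Hp; rewrite /= H0 /last_such.
elim: {-2}n (leqnn n) => //= m IH Hm.
by rewrite IH ?(ltnW Hm) // -Hp //; case: eqP.
Qed.

Lemma last_suchP n (p : pred nat) i : i < n -> p i -> (last_such n p < n) && p (last_such n p).
Proof.
rewrite /last_such; elim: n => //= m IH; rewrite ltnS leq_eqVlt.
case: ifP => [-> _ _|Hm]; first by rewrite ltnSn.
case/orP=> [/eqP-> Hi|Hi Pi]; first by rewrite Hi in Hm.
by case/andP: (IH Hi Pi) => H ->; rewrite andbT ltnW.
Qed.

Definition hp3u n A u v := [exists w : 'I_n, p3 A u v w].
Definition hp3s n A u := [exists v : 'I_n, hp3u n A u v].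

(** The triple inspected by one step. It depends on the adjacency relation alone, so the course of
    the search can be predicted without the machine state. *)
Definition triple n A :=
  let u := last_such n (hp3s n A) in
  let v := last_such n (hp3u n A u) in
  (u, v, last_such n (p3 A u v)).

Lemma eq_last_such n (p q : pred nat) : (forall i, p i = q i) -> last_such n p = last_such n q.
Proof. by move=> H; rewrite /last_such; elim: n => //= m ->; rewrite H. Qed.

Lemma eq_p3 A B u v w : A =2 B -> p3 A u v w = p3 B u v w.
Proof. by move=> H; rewrite /p3 !H. Qed.

Lemma eq_hp3u n A B u v : A =2 B -> hp3u n A u v = hp3u n B u v.
Proof. by move=> H; apply: eq_existsb => w; apply: eq_p3. Qed.

Lemma eq_hp3s n A B u : A =2 B -> hp3s n A u = hp3s n B u.
Proof. by move=> H; apply: eq_existsb => w; apply: eq_hp3u. Qed.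

Lemma eq_triple n A B : A =2 B -> triple n A = triple n B.
Proof.
move=> H; rewrite /triple.
have -> : last_such n (hp3s n A) = last_such n (hp3s n B).
  by apply: eq_last_such => i; apply: eq_hp3s.
set u := last_such _ _.
have -> : last_such n (hp3u n A u) = last_such n (hp3u n B u).
  by apply: eq_last_such => i; apply: eq_hp3u.
by congr (_, _); apply: eq_last_such => i; apply: eq_p3.
Qed.

Definition ord_rel n (A : rel nat) : rel 'I_n := fun u v => A u v.

Definition dom n (A : rel nat) := forall u v, A u v -> (u < n) && (v < n).

Lemma last_such_lt n p : 0 < n -> last_such n p < n.
Proof.
case: n => // n _; rewrite /last_such; elim: n => /= [|n IH]; first by case: ifP.
by case: ifP => // _; case: ifP IH => //; lia.
Qed.

(** Each search keeps only vertices that extend to an induced path, so if one exists the chosen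
    triple is one. Testing this single triple therefore decides P3-freeness. *)
Lemma triple_p3free n A : dom n A ->
  let: (u, v, w) := triple n A in ~~ p3 A u v w -> p3free (@ord_rel n A).
Proof.
move=> dA; rewrite /triple; set u := last_such _ _; set v := last_such _ _.
set w := last_such _ _; move=> /negP H x y z xy yz xz; apply/negPn/negP=> nxz.
have P3 : p3 A x y z by apply/and4P.
have /andP[_ Hu] : (u < n) && hp3s n A u.
  apply: (@last_suchP _ _ x) => //; apply/existsP; exists y; apply/existsP.
  by exists z.
have /existsP[y' Hy'] := Hu.
have /andP[_ Hv] : (v < n) && hp3u n A u v by apply: (@last_suchP _ _ y').
have /existsP[z' Hz'] := Hv.
by have /andP[_ /H] : (w < n) && p3 A u v w by apply: (@last_suchP _ _ z').
Qed.

(** * The search tree *)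

Definition delN (A : rel nat) u v : rel nat :=
  fun x y => A x y && ~~ (((x == u) && (y == v)) || ((x == v) && (y == u))).

Lemma addr_inj n u v x y : v < n -> y < n -> n * u + v = n * x + y ->
  u = x /\ v = y.
Proof.
move=> Hv Hy E; have n0 : 0 < n by lia.
have := congr1 (fun m => m %/ n) E; have := congr1 (fun m => m %% n) E.
by rewrite !(mulnC n) !modnMDl !divnMDl // !modn_small // !divn_small // !addn0.
Qed.

Lemma madj_del n s u v : s.1 0 = n -> s.1 3 = n * n -> u < n -> v < n ->
  madj n (sem (del_edge u v) s).2 =2 delN (madj n s.2) u v.
Proof.
move=> H0 H3 Hu Hv x y.
have -> : (sem (del_edge u v) s).2 =
    upd (upd s.2 (n * n + (n * u + v)) 0) (n * n + (n * v + u)) 0.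
  by rewrite -(eval_eaddr u v H0 H3) -(@eval_eaddr n v u (s.1, upd s.2 (eval (eaddr u v) s) 0)).
rewrite /delN /madj; have [Hx|//] /= := ltnP x n; have [Hy|//] /= := ltnP y n.
have addrE p q : p < n -> q < n ->
   (n * n + (n * x + y) == n * n + (n * p + q)) = (x == p) && (y == q).
  move=> Hp Hq; rewrite eqn_add2l; apply/eqP/andP => [/addr_inj[] // -> ->|[/eqP-> /eqP->]] //.
by rewrite /upd !addrE //; case: ((x == u) && (y == v)); case: ((x == v) && (y == u)); rewrite /= ?andbF ?andbT.
Qed.

Lemma sem_let e f s x : eval e s = x -> sem (CLet e f) s = sem (f x) s.
Proof. by move=> <-. Qed.

Lemma sem_step n eta K s u v w : 0 < n -> regs_ok n eta K s.1 ->
  triple n (madj n s.2) = (u, v, w) ->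
  let c := s.1 10 + s.1 10 in
  let s' := sem stepc s in
  s'.1 10 = (if 2 ^ K <= c then c - 2 ^ K else c) /\
  if p3 (madj n s.2) u v w then
    s'.1 11 = (s.1 11).-1 /\
    madj n s'.2 =2 (if 2 ^ K <= c then delN (madj n s.2) u v
                    else delN (madj n s.2) v w)
  else s'.1 11 = s.1 11 /\ s'.2 = s.2.
Proof.
move=> n0 [H0 H2 H3 H4 [H5 H6]].
set A := madj n s.2; rewrite /triple => -[].
have Ep3u x y : x < n -> y < n -> (eval (ep3u x y) s != 0) = hp3u n A x y.
  by move=> Hx Hy; apply: esum_neq0 => // z Hz; apply: eval_ep3.
have Ep3s x : x < n -> (eval (ep3s x) s != 0) = hp3s n A x.
  by move=> Hx; apply: esum_neq0 => // y Hy; apply: Ep3u.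
have Eu := eval_elast H0 Ep3s.
have := last_such_lt (hp3s n A) n0 => /[swap] Hu'; rewrite Hu' => Hu; rewrite Hu' in Eu.
have Ev := eval_elast H0 (fun y => Ep3u u y Hu).
have := last_such_lt (hp3u n A u) n0 => /[swap] Hv'; rewrite Hv' => Hv; rewrite Hv' in Ev.
have Ew := eval_elast H0 (fun z => eval_ep3 H0 H3 Hu Hv).
have := last_such_lt (p3 A u v) n0 => /[swap] Hw'; rewrite Hw' => Hw; rewrite Hw' in Ew.
have -> : sem stepc s = sem (branchc u v w) s.
  by rewrite /stepc (sem_let _ Eu) (sem_let _ Ev) (sem_let _ Ew).
set c := s.1 10 + s.1 10.
pose s1 : state := (upd s.1 10 c, s.2).
have P1 : (eval (ep3 u v w) s1 == 0) = ~~ p3 A u v w.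
  by rewrite -(@eval_ep3 n u v w s1) ?negbK.
have bE (R : nat -> nat) M : R 10 = c -> R 5 = 2 ^ K ->
    (eval bit (R, M) == 0) = (c < 2 ^ K).
  move=> E1 E2; rewrite /= E1 E2; have := expn_gt0 2 K; lia.
pose s2 := sem (CIf (ep3 u v w) (CSeq (CAsgn 11 (ESub (EReg 11) (ECst 1)))
  (CIf bit (del_edge u v) (del_edge v w))) CSkip) s1.
have del2 x y (t : state) : (sem (del_edge x y) t).1 = t.1 by [].
have Es2 : s2.1 10 = c /\ s2.1 5 = 2 ^ K /\
    if p3 A u v w then
      s2.1 11 = (s.1 11).-1 /\
      madj n s2.2 =2 (if 2 ^ K <= c then delN A u v else delN A v w)
    else s2.1 11 = s.1 11 /\ s2.2 = s.2.
  pose t : state := (upd s1.1 11 (s1.1 11 - 1), s1.2).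
  rewrite /s2 -[sem (CIf _ _ _) s1]/(if eval (ep3 u v w) s1 == 0 then s1
    else if eval bit t == 0 then sem (del_edge v w) t else sem (del_edge u v) t).
  have -> : (eval bit t == 0) = (c < 2 ^ K) by apply: bE.
  rewrite P1; case: (p3 A u v w); last by [].
  have t11 : t.1 11 = (s.1 11).-1 by rewrite /t /s1 /upd /= subn1.
  rewrite [2 ^ K <= c]leqNgt; case: (c < 2 ^ K); rewrite ?del2; do !split=> //.
    exact: madj_del.
  exact: madj_del.
have [E1 [E2 E3]] := Es2.
rewrite -[sem _ s]/(upd s2.1 10 (eval (EIte bit (ESub (EReg 10) (EReg 5)) (EReg 10)) s2), s2.2).
split; last by case: ifP E3.
rewrite -[LHS]/(if eval bit s2 == 0 then s2.1 10 else s2.1 10 - s2.1 5).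
have -> : (eval bit s2 == 0) = (c < 2 ^ K) by rewrite [s2]surjective_pairing; apply: bE.
by rewrite E1 E2 [2 ^ K <= c]leqNgt; case: (c < 2 ^ K).
Qed.

Lemma eq_sol n (a b : rel 'I_n) eta k : a =2 b -> sol a eta k -> sol b eta k.
Proof.
move=> E [l [Hv Hb Hc]]; exists l; split=> //.
  by move=> x y xy lxy; rewrite -E; apply: Hv.
apply: leq_trans Hc; apply: leq_sum => x _; apply: leq_sum => y _.
by rewrite E.
Qed.

Definition graph n (A : rel nat) :=
  [/\ dom n A, symmetric A & irreflexive A].

Lemma graph_del n A u v : graph n A -> graph n (delN A u v).
Proof.
move=> [d s i]; split.
- by move=> x y /andP[/d].
- move=> x y; rewrite /delN s; congr (_ && ~~ _).
  by rewrite orbC; congr (_ || _); rewrite andbC.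
- by move=> x; rewrite /delN i.
Qed.

Lemma eq_graph n A B : A =2 B -> graph n A -> graph n B.
Proof.
move=> E [d s i]; split.
- by move=> x y; rewrite -E; apply: d.
- by move=> x y; rewrite -!E s.
- by move=> x; rewrite -E i.
Qed.

Lemma p3_branch n A u v w eta k : graph n A -> p3 A u v w ->
  sol (@ord_rel n A) eta k.+1 <->
  sol (@ord_rel n (delN A u v)) eta k \/ sol (@ord_rel n (delN A v w)) eta k.
Proof.
move=> [d s i] /and4P[uv vw uw nuw].
have /andP[Hu Hv] := d _ _ uv; have /andP[_ Hw] := d _ _ vw.
apply: (@sol_branch n (@ord_rel n A) eta k (Ordinal Hu) (Ordinal Hv) (Ordinal Hw)) => //.
- by move=> x y; apply: s.
- by apply: contraTneq uv => -[->]; rewrite i.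
- by apply: contraTneq vw => -[->]; rewrite i.
Qed.

(** Holds for arbitrary bits: a step does nothing or moves to one of the two children with one unit
    less. The hypothesis [j <= s.1 11] keeps the truncated decrement exact. *)
Lemma search_sound n eta K j s : j <= n * n -> regs_ok n eta K s.1 ->
  graph n (madj n s.2) -> j <= s.1 11 ->
  let s' := iter j (sem stepc) s in
  graph n (madj n s'.2) /\ s'.1 11 <= s.1 11 /\
  (sol (@ord_rel n (madj n s'.2)) eta (s'.1 11) ->
   sol (@ord_rel n (madj n s.2)) eta (s.1 11)).
Proof.
move=> Hjn; elim: j Hjn s => [|j IH] Hjn s ok G Hj; first by split.
have n0 : 0 < n by case: (n) Hjn.
have {}IH := IH (ltnW Hjn).
rewrite iterSr; set s1 := sem stepc s.
have ok1 : regs_ok n eta K s1.1 by apply: regs_ok_sem (pcmd_step [::]) ok.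
case E: (triple n (madj n s.2)) => [[u v] w].
have [_] := sem_step n0 ok E.
rewrite -/s1; case: ifP => [P3 [E11 EA]|_ [E11 EA]]; last first.
  by have := IH s1 ok1; rewrite E11 EA; apply=> //; apply: ltnW.
have G1 : graph n (madj n s1.2).
  have EA' x y := esym (EA x y).
  by apply: eq_graph EA' _; case: ifP => _; apply: graph_del.
have [|G2 [Hle H]] := IH s1 ok1 G1; first by rewrite E11; lia.
split=> //; split; first by rewrite E11 in Hle; lia.
move=> /H; rewrite E11.
have {2}-> : s.1 11 = (s.1 11).-1.+1 by lia.
rewrite (p3_branch _ _ G P3); case: ifP EA => _ EA S; [left|right]; apply: eq_sol S => x y; exact: EA.
Qed.

Lemma search_complete n eta K : K <= n * n -> forall j A b, j <= K -> graph n A ->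
  b = j \/ p3free (@ord_rel n A) -> sol (@ord_rel n A) eta b ->
  exists2 y, y < 2 ^ j & forall s, regs_ok n eta K s.1 -> madj n s.2 =2 A ->
    s.1 11 = b -> s.1 10 = y * 2 ^ (K - j) ->
    let s' := iter j (sem stepc) s in
    p3free (@ord_rel n (madj n s'.2)) /\
    sol (@ord_rel n (madj n s'.2)) eta (s'.1 11).
Proof.
move=> HKn; elim=> [|j IH] A b Hj G Hb Hs.
  exists 0 => // s ok EA Eb _ /=; rewrite Eb; split; last first.
    by apply: eq_sol Hs => x y; rewrite /ord_rel EA.
  have F : p3free (@ord_rel n A).
    case: Hb => // b0; apply: (@sol0_p3free _ _ eta); last by rewrite -b0.
    by case: G => _ _ i x; apply: i.
  by move=> x y z; rewrite /ord_rel !EA; apply: F.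
have n0 : 0 < n by case: (n) (leq_trans Hj HKn).
have HK : 2 ^ (K - j.+1) * 2 = 2 ^ (K - j).
  by rewrite -expnSr; congr (2 ^ _); lia.
have HKj : 2 ^ j * 2 ^ (K - j) = 2 ^ K by rewrite -expnD subnKC // ltnW.
case E : (triple n A) => [[u v] w].
have Et M : madj n M =2 A -> triple n (madj n M) = (u, v, w).
  by move=> EA; rewrite (eq_triple n EA).
have := @triple_p3free n A; case: (G) => dA _ _ /(_ dA); rewrite E => F.
have [P3|P3] := boolP (p3 A u v w); last first.
  have {}F := F P3; have [|y Hy H] := IH A b (ltnW Hj) G _ Hs; first by right.
  (* Nothing to branch on: the step merely discards a leading 0 bit. *)
  exists y => [|s ok EA Eb Ec]; first by rewrite expnS; lia.
  rewrite iterSr; apply: H.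
  - by apply: regs_ok_sem (pcmd_step [::]) ok.
  - by move=> p q; rewrite -EA; have := sem_step n0 ok (Et _ EA); rewrite (eq_p3 _ _ _ EA) (negbTE P3) => -[_ [_ ->]].
  - by have := sem_step n0 ok (Et _ EA); rewrite (eq_p3 _ _ _ EA) (negbTE P3) => -[_ [-> _]].
  - have := sem_step n0 ok (Et _ EA); move=> -[-> _].
    rewrite Ec addnn -muln2 -mulnA HK ifN // -ltnNge -HKj ltn_mul2r Hy andbT.
    by rewrite expn_gt0.
have {F} Hb : b = j.+1.
  case: Hb => // Fr; case/and4P: P3 => uv vw uw nuw.
  have /andP[Hu Hv] := dA _ _ uv; have /andP[_ Hw] := dA _ _ vw.
  have := Fr (Ordinal Hu) (Ordinal Hv) (Ordinal Hw) uv vw nuw.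
  by rewrite /ord_rel /= (negbTE uw).
rewrite {}Hb in Hs *.
have key B (h : bool) : graph n B -> sol (@ord_rel n B) eta j ->
    B = (if h then delN A u v else delN A v w) ->
    exists2 y, y < 2 ^ j.+1 & forall s, regs_ok n eta K s.1 -> madj n s.2 =2 A ->
    s.1 11 = j.+1 -> s.1 10 = y * 2 ^ (K - j.+1) ->
    let s' := iter j.+1 (sem stepc) s in
    p3free (@ord_rel n (madj n s'.2)) /\
    sol (@ord_rel n (madj n s'.2)) eta (s'.1 11).
  move=> GB SB EB; have [|y Hy H] := IH B j (ltnW Hj) GB _ SB; first by left.
  (* The current choice becomes the top one of [j.+1] bits; doubling carries it to position [K],
     where it is tested and removed. *)
  exists (h * 2 ^ j + y) => [|s ok EA Eb Ec].
    by rewrite expnS; case: (h); lia.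
  have c2 : s.1 10 + s.1 10 = h * 2 ^ K + y * 2 ^ (K - j).
    by rewrite Ec addnn -muln2 -mulnA HK mulnDl -mulnA HKj.
  have cK : (2 ^ K <= s.1 10 + s.1 10) = h.
    rewrite c2; have : y * 2 ^ (K - j) < 2 ^ K.
      by rewrite -HKj ltn_mul2r Hy andbT expn_gt0.
    by case: (h); lia.
  have := sem_step n0 ok (Et _ EA); cbv zeta; rewrite cK c2 (eq_p3 _ _ _ EA) P3.
  move=> [E10 [E11 EM]]; rewrite -/(iter j.+1 (sem stepc) s) iterSr; apply: H.
  - by apply: regs_ok_sem (pcmd_step [::]) ok.
  - move=> p q; rewrite EM EB; case: (h); by rewrite /delN EA.
  - by rewrite E11 Eb.
  - by rewrite E10; case: (h); lia.
have [S|S] := (p3_branch eta j G P3).1 Hs.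
  by apply: (key _ true _ S erefl); apply: graph_del.
by apply: (key _ false _ S erefl); apply: graph_del.
Qed.

(** * The leaves of the search tree *)

Lemma fold_min k (c : pred nat) (v : nat -> nat) INF :
  let r := iteri k (fun p acc => if c p then minn acc (v p) else acc) INF in
  (forall p, p < k -> c p -> r <= v p) /\
  (r = INF \/ exists2 p, p < k & c p /\ r = v p).
Proof.
elim: k => [|k [IH1 IH2]] /=; first by split=> //; left.
set r := iteri k _ _ in IH1 IH2 *; split=> [p|].
  rewrite ltnS leq_eqVlt => /orP[/eqP-> ->|Hp cp]; first by rewrite geq_minr.
  by case: ifP => _; [rewrite geq_min IH1|rewrite IH1].
case: ifP => ck; last first.
  by case: IH2 => [->|[p Hp H]]; [left|right; exists p => //; apply: ltnW].
rewrite /minn; case: ifP => _; last by right; exists k.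
by case: IH2 => [->|[p Hp H]]; [left|right; exists p => //; apply: ltnW].
Qed.

Lemma sum_below N p x : \sum_(i < N) (if p - i == 0 then 0 else x) = minn p N * x.
Proof.
elim: N => [|N IH]; first by rewrite big_ord0 minn0.
rewrite big_ord_recr /= IH; case: eqP => H; last first.
  by rewrite -mulSnr; congr (_ * _); lia.
by rewrite addn0; congr (_ * _); lia.
Qed.

Lemma eval_epart n eta K st s m p : regs_ok n eta K st.1 ->
  (eval (epart s m p) st == 0) = ~~ (part_ok s eta p && (p <= m)).
Proof.
move=> [_ H2 _ _ _]; rewrite /= H2 /part_ok.
by do !case: eqP => //=; lia.
Qed.

Lemma eval_esplit n eta K st m p : regs_ok n eta K st.1 -> p <= n ->
  eval (esplit m p) st = st.2 (n * n + n * n + (m - p)) + (p * (m - p)).*2.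
Proof.
move=> [_ _ H3 _ [_ H6]] Hp.
rewrite -[LHS]/(st.2 (st.1 3 + st.1 3 + (m - p)) + eval (esum 6 (fun i =>
  EIte (ESub (EVar p) (EVar i))
        (EAdd (ESub (EVar m) (EVar p)) (ESub (EVar m) (EVar p))) (ECst 0))) st).
rewrite eval_esum H3 H6 /= sum_below (minn_idPl _); last by lia.
by congr (_ + _); rewrite addnn -doubleMr.
Qed.

Lemma table_regs s st : (sem (tablec s) st).1 = st.1.
Proof. by rewrite /=; elim: (st.1 6) => //= i ->. Qed.

(** Entries are written in increasing order of [m]; parts are nonempty, so the recursion reads only
    entries that are already final. *)
Lemma table_spec n eta K s st : regs_ok n eta K st.1 ->
  let base := n * n + n * n in
  let M := (sem (tablec s) st).2 in
  (forall x, x < base -> M x = st.2 x) /\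
  split_table n s eta base.+1 (fun m => M (base + m)).
Proof.
move=> ok base; have [H0 H2 H3 H4 [H5 H6]] := ok.
set f := fun m => CWrite (etab (EVar m)) (EIte (EVar m) (ebest s m) (ECst 0)).
pose S i := iteri i (fun i => sem (f i)) st.
have SR i : (S i).1 = st.1 by elim: i => //= i ->.
pose row (g : nat -> nat) m := if m == 0 then g 0 = 0 else
   (forall p, p <= m -> part_ok s eta p -> g m <= g (m - p) + (p * (m - p)).*2) /\
   (base.+1 <= g m \/ exists2 p, p <= m & part_ok s eta p /\ g m = g (m - p) + (p * (m - p)).*2).
have inv i : i <= n.+1 -> (forall x, x < base -> (S i).2 x = st.2 x) /\
    (forall m, m < i -> row (fun m => (S i).2 (base + m)) m).
  elim: i => // i IH Hi; have [I1 I2] := IH (ltnW Hi).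
  pose v := eval (EIte (EVar i) (ebest s i) (ECst 0)) (S i).
  have ES : (S i.+1).2 = upd (S i).2 (base + i) v.
    by rewrite -[LHS]/(upd (S i).2 ((S i).1 3 + (S i).1 3 + i) v) SR H3.
  have low m : m < i -> (S i.+1).2 (base + m) = (S i).2 (base + m).
    by move=> Hm; rewrite ES upd_other //; lia.
  have Ei : (S i.+1).2 (base + i) = v by rewrite ES upd_same.
  split=> [x Hx|m]; first by rewrite ES upd_other ?I1 //; lia.
  rewrite ltnS leq_eqVlt => /orP[/eqP->|Hm]; last first.
    have := I2 m Hm; rewrite /row; case: eqP => m0; first by rewrite low //; lia.
    move=> [J1 J2]; split=> [p Hp Hok|].
      have /andP[p0 _] := Hok; rewrite !low //; [exact: J1|lia].
    case: J2 => [J|[p Hp [Hok J]]]; [left|right]; first by rewrite low.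
    by exists p => //; split=> //; have /andP[p0 _] := Hok; rewrite !low //; lia.
  rewrite /row; case: eqP => i0; first by rewrite -{1}i0 Ei /v i0.
  have Ev : v = iteri n.+1 (fun p acc => if part_ok s eta p && (p <= i)
      then minn acc ((S i).2 (base + (i - p)) + (p * (i - p)).*2) else acc) base.+1.
    rewrite /v -[LHS]/(if i == 0 then 0 else iteri ((S i).1 6) (fun p acc =>
       if eval (epart s i p) (S i) == 0 then acc else
       if acc - eval (esplit i p) (S i) == 0 then acc else eval (esplit i p) (S i))
       ((S i).1 3 + (S i).1 3 + 1)).
    rewrite ifN; last by lia.
    have ok' : regs_ok n eta K (S i).1 by rewrite SR.
    rewrite SR H3 H6 addn1.
    move: (leqnn n.+1); elim: {1 3 4}n.+1 => // k IHk Hk.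
    rewrite !iteriS (IHk (ltnW Hk)).
    rewrite (eval_epart _ _ _ ok') (eval_esplit _ ok') //.
    move: (iteri _ _ _) (_ + _) (_ && _) => acc x [] //=.
    by rewrite subn_eq0 /minn; case: leqP => H; case: ltnP; lia.
  have [J1 J2] := fold_min n.+1 (fun p => part_ok s eta p && (p <= i))
    (fun p => (S i).2 (base + (i - p)) + (p * (i - p)).*2) base.+1.
  rewrite -Ev in J1 J2; rewrite Ei; split=> [p Hp Hok|].
    by have /andP[p0 _] := Hok; rewrite low ?J1 ?Hok //; lia.
  case: J2 => [->|[p Hp [/andP[Hok Hpi] J]]]; [by left|right].
  by exists p => //; split=> //; have /andP[p0 _] := Hok; rewrite low //; lia.
have -> : sem (tablec s) st = S n.+1 by rewrite /tablec -[sem _ _]/(S (st.1 6)) H6.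
have [I1 I2] := inv n.+1 (leqnn _); split=> //; split; first exact: (I2 0).
by move=> m /andP[m0 Hm]; have := I2 m Hm; rewrite /row ifN //; lia.
Qed.

Lemma madj_agree n M M' : (forall x, x < n * n + n * n -> M x = M' x) ->
  madj n M =2 madj n M'.
Proof.
move=> H u v; rewrite /madj; case: ltnP => //= Hu; case: ltnP => //= Hv.
rewrite H // ltn_add2l.
have : n * u + n <= n * n by rewrite -mulnSr leq_mul.
lia.
Qed.

Lemma eval_etotal n eta K st : regs_ok n eta K st.1 ->
  let a := @ord_rel n (madj n st.2) in
  eval etotal st = \sum_(v | least a v) st.2 (n * n + n * n + (\sum_y a v y).+1).
Proof.
move=> [H0 _ H3 _ _] a; rewrite eval_esum H0 [RHS]big_mkcond.
have adjE (x y : 'I_n) : (eval (eadj x y) st != 0) = a x y.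
  by rewrite /a /ord_rel /madj !ltn_ord -(eval_eaddr x y H0 H3).
apply: eq_bigr => v _.
pose e1 := esum 0 (fun u => eand (ESub (EVar v) (EVar u)) (eadj u v)).
pose e2 := esum 0 (fun y => eand (eadj v y) (ECst 1)).
have E1 : (eval e1 st == 0) = least a v.
  apply: negb_inj; rewrite (@esum_neq0 0 n _ _ (fun u => (u < v) && madj n st.2 u v)) //.
    rewrite negb_forall; apply: eq_existsb => u.
    by rewrite negb_imply negbK.
  move=> u Hu; rewrite -[eval _ st]/(if v - u == 0 then 0 else eval (eadj u v) st).
  rewrite subn_eq0 leqNgt; case: ltnP => //= _.
  exact: (adjE (Ordinal Hu)).
have E2 : eval e2 st = \sum_y a v y.
  rewrite eval_esum H0; apply: eq_bigr => y _.
  rewrite -[eval _ st]/(if eval (eadj v y) st == 0 then 0 else 1) -adjE.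
  by case: eqP.
rewrite -[LHS]/(if eval e1 st == 0 then st.2 (st.1 3 + st.1 3 + (1 + eval e2 st)) else 0).
by rewrite E1 E2 H3.
Qed.

Lemma eval_p3free n eta K st : regs_ok n eta K st.1 ->
  eval (esum 0 ep3s) st = 0 <-> p3free (@ord_rel n (madj n st.2)).
Proof.
move=> [H0 _ H3 _ _].
have E : (eval (esum 0 ep3s) st != 0) =
   [exists u : 'I_n, hp3s n (madj n st.2) u].
  apply: esum_neq0 => // u Hu; apply: esum_neq0 => // v Hv.
  by apply: esum_neq0 => // w Hw; apply: eval_ep3.
split.
  move=> /eqP; rewrite -[_ == 0]negbK E negb_exists => /forallP H u v w uv vw uw.
  apply: contraNT (H u) => nuw; apply/existsP; exists v; apply/existsP; exists w.
  exact/and4P.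
move=> H; apply/eqP; rewrite -[_ == 0]negbK E; apply/existsP=> -[u /existsP[v /existsP[w]]].
by case/and4P=> uv vw /negP uw /(H u v w uv vw).
Qed.

Lemma check_spec n eta K st : regs_ok n eta K st.1 ->
  let a := @ord_rel n (madj n st.2) in
  let st' := sem checkc st in
  [/\ st'.2 = st.2, st'.1 11 = st.1 11 &
   st'.1 12 != 0 <-> st.1 12 != 0 \/ p3free a /\
     \sum_(v | least a v) st.2 (n * n + n * n + (\sum_y a v y).+1) <= (st.1 11).*2].
Proof.
move=> ok a; cbv zeta; rewrite -(eval_etotal ok).
have Ep := eval_p3free ok; rewrite -/a in Ep.
rewrite -[sem checkc st]/(if (if 1 - eval (esum 0 ep3s) st == 0 then 0
   else 1 - (eval etotal st - (st.1 11 + st.1 11))) == 0 then st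
   else (upd st.1 12 1, st.2)).
move: (eval (esum 0 ep3s) st) (eval etotal st) Ep => p q Ep.
split; [by case: ifP|by case: ifP|rewrite -Ep {Ep}].
case: ifP => H; last first.
  split=> // _; right; move: H; case: p => [|p] //.
  by rewrite subn0 /= => H; split=> //; lia.
split; first by left.
by case=> // -[p0 Hq]; move: H; rewrite p0 /=; lia.
Qed.

(** Tables are written from address [2n^2] on, so every [s] is checked against the same graph. The
    bound on register 11 keeps twice the budget below the cap. *)
Lemma leaf_spec n eta K st : regs_ok n eta K st.1 -> graph n (madj n st.2) ->
  st.1 11 <= n * n ->
  let a := @ord_rel n (madj n st.2) in
  let st' := sem leafc st in
  (forall x, x < n * n + n * n -> st'.2 x = st.2 x) /\
  (st'.1 12 != 0 <-> st.1 12 != 0 \/ p3free a /\ sol a eta (st.1 11)).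
Proof.
move=> ok G Hb a; cbv zeta; have [H0 H2 H3 H4 [H5 H6]] := ok.
pose f s := CSeq (tablec s) checkc.
pose S i := iteri i (fun i => sem (f i)) st.
pose T i := sem (tablec i) (S i).
have okS i : regs_ok n eta K (S i).1.
  elim: i => // i IH; rewrite -[S i.+1]/(sem (f i) (S i)).
  apply: (@regs_ok_sem _ _ _ [:: (0, i)] (f 0)) => //.
  by apply: pSeq; [apply: pcmd_table|apply: pcmd_check].
have okT i : regs_ok n eta K (T i).1 by rewrite table_regs.
pose g s m := (T s).2 (n * n + n * n + m).
have inv i : [/\ (forall x, x < n * n + n * n -> (S i).2 x = st.2 x),
   (S i).1 11 = st.1 11 &
   (S i).1 12 != 0 <-> st.1 12 != 0 \/ p3free a /\ exists2 s, s < i &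
      \sum_(v | least a v) g s (\sum_y a v y).+1 <= (st.1 11).*2].
  elim: i => [|i [I1 I2 I3]].
    by split=> //; split; [left|case=> // -[_ [s]]].
  have [T1 _] := table_spec i (okS i).
  have TM x : x < n * n + n * n -> (T i).2 x = st.2 x by move=> Hx; rewrite T1 ?I1.
  have Ta : @ord_rel n (madj n (T i).2) =2 a by move=> u v; apply: madj_agree.
  have TR : (T i).1 = (S i).1 by rewrite table_regs.
  have [C1 C2 C3] := check_spec (okT i).
  rewrite -[S i.+1]/(sem checkc (T i)); split.
  - by rewrite C1.
  - by rewrite C2 TR.
  - have Ep : p3free (@ord_rel n (madj n (T i).2)) <-> p3free a.
      by split=> H u v w; have := H u v w; rewrite !Ta.
    have El : least (@ord_rel n (madj n (T i).2)) =1 least a.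
      by move=> v; apply: eq_forallb => u; rewrite Ta.
    have Es : \sum_(v | least (@ord_rel n (madj n (T i).2)) v) (T i).2
         (n * n + n * n + (\sum_y @ord_rel n (madj n (T i).2) v y).+1) =
       \sum_(v | least a v) g i (\sum_y a v y).+1.
      rewrite (eq_bigl _ _ El); apply: eq_bigr => v _; rewrite /g.
      by congr ((T i).2 (_ + _.+1)); apply: eq_bigr => y _; rewrite Ta.
    rewrite {}C3 Ep Es TR I2 I3; split.
      case=> [[|[F [s Hs H]]]|[F H]]; first by left.
        by right; split=> //; exists s => //; apply: ltnW.
      by right; split=> //; exists i.
    case=> [|[F [s]]]; first by left; left.
    rewrite ltnS leq_eqVlt => /orP[/eqP-> H|Hs H]; first by right.
    by left; right; split=> //; exists s.
have [I1 I2 I3] := inv n.+1.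
rewrite -[sem leafc st]/(S (st.1 6)) H6; split=> //; rewrite {}I3.
case: G => dA sA iA.
have SC (F : p3free a) : sol a eta (st.1 11) <-> exists2 s, s < n.+1 &
      \sum_(v | least a v) g s (\sum_y a v y).+1 <= (st.1 11).*2.
  have sa : symmetric a by move=> x y; apply: sA.
  have ia : irreflexive a by move=> x; apply: iA.
  apply: (@sol_cluster n a sa ia F eta (st.1 11) (n * n + n * n).+1 g).
    by rewrite ltnS -addnn leq_add.
  by move=> s _; have [_] := table_spec s (okS s).
by split=> -[|[F /(SC F) H]]; [left|right|left|right].
Qed.

(** * One iteration of the main loop *)

Lemma del_edge_mem s u v x : x < s.1 3 -> (sem (del_edge u v) s).2 x = s.2 x.
Proof. by move=> Hx; rewrite /= !upd_other //; lia. Qed.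

Lemma branch_frame u v w s : let s' := sem (branchc u v w) s in
  s'.1 12 = s.1 12 /\ forall x, x < s.1 3 -> s'.2 x = s.2 x.
Proof.
pose s1 : state := (upd s.1 10 (s.1 10 + s.1 10), s.2).
pose t : state := (upd s1.1 11 (s1.1 11 - 1), s1.2).
pose s2 := if eval (ep3 u v w) s1 == 0 then s1
   else if eval bit t == 0 then sem (del_edge v w) t else sem (del_edge u v) t.
have -> : sem (branchc u v w) s =
   (upd s2.1 10 (eval (EIte bit (ESub (EReg 10) (EReg 5)) (EReg 10)) s2), s2.2) by [].
rewrite /s2; case: (_ == 0); first by [].
by case: (_ == 0); split=> // x Hx; apply: (@del_edge_mem t).
Qed.

Lemma step_frame s : let s' := sem stepc s in
  s'.1 12 = s.1 12 /\ forall x, x < s.1 3 -> s'.2 x = s.2 x.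
Proof.
rewrite /stepc (sem_let _ erefl) (sem_let _ erefl) (sem_let _ erefl).
exact: branch_frame.
Qed.

Lemma iter_step_frame n eta K s j : regs_ok n eta K s.1 ->
  let s' := iter j (sem stepc) s in
  [/\ regs_ok n eta K s'.1, s'.1 12 = s.1 12 &
      forall x, x < n * n -> s'.2 x = s.2 x].
Proof.
move=> ok; cbv zeta; elim: j => // j; rewrite iterS; set t := iter j _ _ => -[okj <- E].
have [_ _ H3 _ _] := okj; have [-> F] := step_frame t.
split=> //; first by apply: regs_ok_sem (pcmd_step [::]) okj.
by move=> x Hx; rewrite F ?E // H3.
Qed.

Definition badj n (M : nat -> nat) : rel nat :=
  fun u v => [&& u < n, v < n & M (n * u + v) != 0].

Lemma copy_spec n eta K st : regs_ok n eta K st.1 ->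
  let st' := sem copyc st in
  [/\ st'.1 = st.1, forall x, x < n * n -> st'.2 x = st.2 x &
      madj n st'.2 =2 badj n st.2].
Proof.
move=> [H0 _ H3 _ _].
pose f i := CWrite (EAdd (EReg 3) (EVar i)) (ERead (EVar i)).
pose S i := iteri i (fun i => sem (f i)) st.
have inv i : i <= n * n -> [/\ (S i).1 = st.1, forall x, x < n * n -> (S i).2 x = st.2 x &
    forall x, x < i -> (S i).2 (n * n + x) = st.2 x].
  elim: i => // i IH Hi; have [I1 I2 I3] := IH (ltnW Hi).
  have ES : (S i.+1).2 = upd (S i).2 (n * n + i) (st.2 i).
    by rewrite -[LHS]/(upd (S i).2 ((S i).1 3 + i) ((S i).2 i)) I1 H3 I2.
  split=> // x Hx; rewrite ES; first by rewrite upd_other ?I2 //; lia.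
  have [->|xi] := eqVneq x i; first by rewrite upd_same.
  by rewrite upd_other ?I3 //; lia.
have -> : sem copyc st = S (n * n) by rewrite -H3.
have [I1 I2 I3] := inv _ (leqnn _); split=> // u v.
rewrite /madj /badj; case: ltnP => //= Hu; case: ltnP => //= Hv; rewrite I3 //.
have : n * u + n <= n * n by rewrite -mulnSr leq_mul.
lia.
Qed.

Lemma iteri_const (T : Type) k (f : T -> T) x : iteri k (fun=> f) x = iter k f x.
Proof. by elim: k => //= k ->. Qed.

Lemma badj_agree n M M' : (forall x, x < n * n -> M x = M' x) ->
  badj n M =2 badj n M'.
Proof.
move=> H u v; rewrite /badj; case: ltnP => //= Hu; case: ltnP => //= Hv.
rewrite H //; have : n * u + n <= n * n by rewrite -mulnSr leq_mul.
lia.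
Qed.

(** The state [s2], at the root of the tree, is exposed so that soundness and completeness of the
    search can both be applied to it. *)
Lemma body_spec n eta K x st : K <= n * n -> regs_ok n eta K st.1 ->
  graph n (badj n st.2) ->
  exists s2, [/\ regs_ok n eta K s2.1, madj n s2.2 =2 badj n st.2,
    s2.1 11 = K, s2.1 10 = x &
    let s3 := iter K (sem stepc) s2 in
    let a := @ord_rel n (madj n s3.2) in
    let st' := sem (bodyc x) st in
    (forall y, y < n * n -> st'.2 y = st.2 y) /\
    (st'.1 12 != 0 <-> st.1 12 != 0 \/ p3free a /\ sol a eta (s3.1 11))].
Proof.
move=> HK ok G; have [C1 C2 C3] := copy_spec ok.
have [H0 H2 H3 H4 [H5 H6]] := ok.
set s1 := sem copyc st in C1 C2 C3.
pose s2 : state := (upd (upd s1.1 10 x) 11 K, s1.2).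
have ok2 : regs_ok n eta K s2.1 by rewrite /s2 C1.
have E2 : madj n s2.2 =2 badj n st.2 by [].
exists s2; split=> //; cbv zeta; set s3 := iter K _ _.
have -> : sem (bodyc x) st = sem leafc s3.
  rewrite /s3 -iteri_const -[sem (bodyc x) st]/(sem leafc (iteri (s1.1 4) (fun=> sem stepc)
    (upd (upd s1.1 10 x) 11 (s1.1 4), s1.2))).
  by have -> : s1.1 4 = K by rewrite C1.
have [ok3 E12 EM] := iter_step_frame K ok2; rewrite -/s3 in ok3 E12 EM.
have G2 : graph n (madj n s2.2) by apply: eq_graph G => u v.
have [|G3 [Hb _]] := search_sound HK ok2 G2; first by [].
rewrite -/s3 in G3 Hb.
have [|L1 L2] := leaf_spec ok3 G3; first exact: leq_trans HK.
split; last by rewrite L2 E12 -[s2.1 12]/(s1.1 12) C1.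
move=> y Hy; rewrite L1; last by lia.
by rewrite EM //; apply: C2.
Qed.

Lemma loop_spec n eta K st : K <= n * n -> regs_ok n eta K st.1 ->
  st.1 12 = 0 -> graph n (badj n st.2) ->
  let S i := iteri i (fun i => sem (bodyc i)) st in
  (forall i, regs_ok n eta K (S i).1) /\
  ((S (2 ^ K)).1 12 != 0 <-> sol (@ord_rel n (badj n st.2)) eta K).
Proof.
move=> HK ok E12 G S.
have okS i : regs_ok n eta K (S i).1.
  elim: i => // i IH; rewrite -[S i.+1]/(sem (bodyc i) (S i)).
  by apply: regs_ok_sem (pcmd_body [::] 0 i) IH.
have SM i : forall y, y < n * n -> (S i).2 y = st.2 y.
  elim: i => // i IH y Hy; rewrite -[S i.+1]/(sem (bodyc i) (S i)).
  have [|s2 [_ _ _ _ [-> //]]] := body_spec i HK (okS i); last by rewrite IH.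
  by apply: eq_graph G => u v; apply: badj_agree => z Hz; rewrite IH.
have GS i : graph n (badj n (S i).2).
  by apply: eq_graph G => u v; apply: badj_agree => z Hz; rewrite SM.
have Sb i : badj n (S i).2 =2 badj n st.2 by move=> u v; apply: badj_agree; apply: SM.
split=> //; split.
  elim: (2 ^ K) => [|i IH]; first by rewrite -[S 0]/st E12.
  rewrite -[S i.+1]/(sem (bodyc i) (S i)).
  have [s2 [ok2 E2 E11 E10 [_ ->]]] := body_spec i HK (okS i) (GS i).
  case=> // -[_ HS].
  have G2 : graph n (madj n s2.2) by apply: eq_graph (GS i) => u v; rewrite E2.
  have Hj : K <= s2.1 11 by rewrite E11.
  have [_ [_ H]] := search_sound HK ok2 G2 Hj.
  have := H HS; rewrite E11; apply: eq_sol => u v; rewrite /ord_rel E2; exact: Sb.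
move=> HS; have [|y Hy H] := search_complete HK (leqnn K) G _ HS; first by left.
have keep i j : (S i).1 12 != 0 -> i <= j -> (S j).1 12 != 0.
  move=> Hi; elim: j => [|j IH]; first by case: (i) Hi.
  rewrite leq_eqVlt => /orP[/eqP<- //|/IH Hj].
  rewrite -[S j.+1]/(sem (bodyc j) (S j)).
  have [s2 [_ _ _ _ [_ ->]]] := body_spec j HK (okS j) (GS j).
  by left.
(* Iteration [y] follows the successful path, and the flag then survives to the end. *)
apply: (keep y.+1) => //; rewrite -[S y.+1]/(sem (bodyc y) (S y)).
have [s2 [ok2 E2 E11 E10 [_ ->]]] := body_spec y HK (okS y) (GS y).
right; apply: H => //; last by rewrite E10 subnn muln1.
by move=> u v; rewrite E2; apply: Sb.
Qed.

Lemma input_badj n (G : sgraph 'I_n) k eta :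
  let A := badj n (Defs.mem (input G k eta)) in
  @ord_rel n A =2 adj G /\ graph n A.
Proof.
set A := badj _ _; cbv zeta.
have E : @ord_rel n A =2 adj G.
  move=> u v; rewrite /ord_rel /A /badj !ltn_ord /= eqb0 negbK.
  apply/existsP/idP => [[u' /existsP[v' /andP[/eqP]]]|uv].
    by rewrite [u' * n]mulnC => /addr_inj[] // /val_inj-> /val_inj->.
  by exists u; apply/existsP; exists v; rewrite mulnC eqxx.
split=> //.
have inA u v : A u v -> (u < n) && (v < n) by case/and3P=> -> ->.
split=> //.
- suff H u v : A u v -> A v u by move=> u v; apply/idP/idP; apply: H.
  move=> /[dup] /inA/andP[Hu Hv].
  rewrite -[A u v]/(@ord_rel n A (Ordinal Hu) (Ordinal Hv)) E => uv.
  by rewrite -[A v u]/(@ord_rel n A (Ordinal Hv) (Ordinal Hu)) E adj_sym.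
- move=> u; apply/negP=> /[dup] /inA/andP[Hu _].
  by rewrite -[A u u]/(@ord_rel n A (Ordinal Hu) (Ordinal Hu)) E adj_irr.
Qed.

(** * The complete program *)

Definition en2 := emul 0 (EReg 0).
Definition ebudget := emin (EReg 1) (EReg 3).
Definition epow := EFold 4 (ECst 1) (fun acc _ => EAdd (EVar acc) (EVar acc)).
Definition en1 := EAdd (EReg 0) (ECst 1).

Definition bcd_cmd :=
  CSeq (CAsgn 3 en2) (CSeq (CAsgn 4 ebudget) (CSeq (CAsgn 5 epow)
    (CSeq (CAsgn 6 en1) (CSeq (CFor 5 bodyc) (CAsgn 0 (EReg 12)))))).

Definition bcd_program : program := compc bcd_cmd nvars 0.

(** Meant for the setup and the final output, which assign registers that [pcmd] protects. *)
Lemma simc_Asgn_pexp r e s v T : r < nvars -> pexp [::] e e -> eval e s = v ->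
  cost e s.1 + 2 <= T -> simc [::] (CAsgn r e) s (upd s.1 r v, s.2) T.
Proof.
move=> Hr He <- HT; apply: simc_leq HT _.
exact: simc_Asgn Hr (pexp_sime He).
Qed.

Lemma bcd_polyb : exists C D, forall R X, {in loop_regs, forall r, R r <= X} ->
  [/\ [/\ cost en2 R + 2 <= C * X.+1 ^ D, cost ebudget R + 2 <= C * X.+1 ^ D,
      cost epow R + 2 <= C * X.+1 ^ D & cost en1 R + 2 <= C * X.+1 ^ D],
      costc (bodyc 0) R + 5 <= C * X.+1 ^ D & 4 <= C * X.+1 ^ D].
Proof.
have P3 : polyb (cost en2) by apply: (@pexp_cost_poly [::] en2); rewrite /en2; pexp_tac.
have P4 : polyb (cost ebudget) by apply: (@pexp_cost_poly [::] ebudget); rewrite /ebudget; pexp_tac.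
have P5 : polyb (cost epow) by apply: (@pexp_cost_poly [::] epow); rewrite /epow; pexp_tac.
have P6 : polyb (cost en1) by apply: (@pexp_cost_poly [::] en1); rewrite /en1; pexp_tac.
have Pb : polyb (costc (bodyc 0)) := pcmd_cost_poly (pcmd_body [::] 0 0).
have := polyb_add (polyb_add (polyb_add P3 P4) (polyb_add P5 P6)) (polyb_add Pb (polyb_cst 5)).
move=> [C [D H]]; exists C, D => R X HR; have := H R X HR.
move: (cost _ _) (cost _ _) (cost _ _) (cost _ _) (costc _ _) (C * _) => a b c d e f Hf.
by split; [split| |]; lia.
Qed.

(* c * n.+1 ^ d is the factor n^{O(1)}, meaningful also for n <= 1. *)
Theorem mainTheorem12 :
  exists (P : program) (c d : nat),
    forall (n : nat) (G : sgraph 'I_n) (k eta : nat),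
      exists t : nat,
        [/\ t <= 2 ^ k * (c * n.+1 ^ d),
            halted P (run P t (input G k eta)) &
            accepting (run P t (input G k eta))
              <-> balanced_cluster_deletion G k eta].
Proof.
have [C [D HC]] := bcd_polyb.
(* With pieces bounded by [B], the total is [4B + 2^K B + 7], and [4 <= B] gives at most
   [7 * 2^K * B]. The factor [2 ^ D] and the exponent [2 * D] come from [X.+1 <= 2 * n.+1 ^ 2]. *)
exists bcd_program, (7 * C * 2 ^ D), (2 * D) => n G k eta.
pose K := minn k (n * n); pose X := n * n + n.+1; pose B := C * X.+1 ^ D.
have KX : K <= n * n by rewrite geq_minr.
pose s0 : state := (nth 0 [:: n; k; eta], Defs.mem (input G k eta)).
pose s1 : state := (upd s0.1 3 (n * n), s0.2).
pose s2 : state := (upd s1.1 4 K, s1.2).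
pose s3 : state := (upd s2.1 5 (2 ^ K), s2.2).
pose s4 : state := (upd s3.1 6 n.+1, s3.2).
pose S i := iteri i (fun i => sem (bodyc i)) s4.
pose s5 : state := (upd (S (2 ^ K)).1 0 ((S (2 ^ K)).1 12), (S (2 ^ K)).2).
have ok4 : regs_ok n eta K s4.1 by [].
have [EA GA] := input_badj G k eta.
have [okS HS] := loop_spec KX ok4 erefl GA.
have bnd (R : nat -> nat) : R 0 <= X -> R 3 <= X -> R 4 <= X -> R 6 <= X ->
    {in loop_regs, forall r, R r <= X}.
  by move=> R0 R3 R4 R6 r; rewrite !inE => /or4P[] /eqP->.
have b0 : {in loop_regs, forall r, s0.1 r <= X} by apply: bnd; rewrite /= /X; lia.
have b1 : {in loop_regs, forall r, s1.1 r <= X}.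
  by apply: bnd; rewrite /s1 /upd /= /X; lia.
have b2 : {in loop_regs, forall r, s2.1 r <= X}.
  by apply: bnd; rewrite /s2 /s1 /upd /= /X; lia.
have b3 : {in loop_regs, forall r, s3.1 r <= X}.
  by apply: bnd; rewrite /s3 /s2 /s1 /upd /= /X; lia.
have bS i : {in loop_regs, forall r, (S i).1 r <= X}.
  have [H0 _ H3 H4 [_ H6]] := okS i.
  by apply: bnd; rewrite ?H0 ?H3 ?H4 ?H6 /X; lia.
have q3 : simc [::] (CAsgn 3 en2) s0 s1 B.
  apply: simc_Asgn_pexp => //; first by rewrite /en2; pexp_tac.
    by rewrite eval_esum /= sum_nat_const card_ord.
  by have [[]] := HC _ _ b0.
have q4 : simc [::] (CAsgn 4 ebudget) s1 s2 B.
  apply: simc_Asgn_pexp => //; first by rewrite /ebudget; pexp_tac.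
    rewrite -[LHS]/(if k - n * n == 0 then k else n * n) /K.
    by case: eqP; lia.
  by have [[]] := HC _ _ b1.
have q5 : simc [::] (CAsgn 5 epow) s2 s3 B.
  apply: simc_Asgn_pexp => //; first by rewrite /epow; pexp_tac.
    rewrite -[LHS]/(iteri K (fun _ acc => acc + acc) 1).
    by elim: (K) => //= m ->; rewrite expnS; lia.
  by have [[]] := HC _ _ b2.
have q6 : simc [::] (CAsgn 6 en1) s3 s4 B.
  apply: simc_Asgn_pexp => //; first by rewrite /en1; pexp_tac.
    by rewrite /= addn1.
  by have [[]] := HC _ _ b3.
have qL : simc [::] (CFor 5 bodyc) (S 0) (S (2 ^ K)) (3 + 2 ^ K * B).
  have Hb : 5 <= B by have [_ + _] := HC _ _ (bS 0); apply: leq_trans; rewrite leq_addl.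
  (* [simc_For] charges five steps of overhead per round, so the body is allotted [B - 5]. *)
  have -> : B = B - 5 + 5 by lia.
  apply: simc_For => //.
    by move=> i _; have [_ _ _ _ []] := okS i.
  move=> x i _; have := @pcmd_simc _ _ _ (S i) (pcmd_body [::] x i).
  rewrite -[sem _ _]/(S i.+1); apply: simc_leq.
  have [_ + _] := HC _ _ (bS i).
  rewrite -(pcmd_cost _ (pcmd_body [::] x 0)) (pcmd_cost _ (pcmd_body [::] x i)).
  by rewrite -/B; lia.
have q0 : simc [::] (CAsgn 0 (EReg 12)) (S (2 ^ K)) s5 4.
  by apply: simc_Asgn_pexp => //; pexp_tac.
have q := simc_Seq q3 (simc_Seq q4 (simc_Seq q5 (simc_Seq q6 (simc_Seq qL q0)))).
have at0 : code_at bcd_program 0 (compc bcd_cmd nvars 0) by move=> i _; rewrite add0n.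
have cok : ctx_ok [::] nvars s0.1 by [].
have [R' [[t Ht Et] HR' _]] := q _ _ 0 s0.1 (fun r _ => erefl) (leqnn _) cok at0.
rewrite add0n -/bcd_program in Et.
exists t; rewrite -[input G k eta]/(Config 0 s0.1 s0.2) Et; split.
- apply: leq_trans Ht _.
  have B4 : 4 <= B by have [_ _] := HC _ _ b0.
  have HX : X.+1 <= 2 * n.+1 ^ 2 by rewrite /X; lia.
  have HB : B <= C * 2 ^ D * n.+1 ^ (2 * D).
    rewrite /B -mulnA leq_mul // expnM -expnMn.
    by case: (D) => // m; rewrite leq_exp2r.
  apply: (@leq_trans (2 ^ K * (7 * B))).
    have HY : B <= 2 ^ K * B by rewrite leq_pmull // expn_gt0.
    by rewrite mulnCA; lia.
  by rewrite leq_mul ?leq_exp2l ?geq_minl // -!mulnA leq_mul // mulnA.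
(* The code contains no [IHalt]: control stops just past its end. *)
- by rewrite /halted /fetch -[pc _]/(size bcd_program) nth_default.
- rewrite /accepting -[reg _]/R' HR' // -[s5.1 0]/((S (2 ^ K)).1 12) HS bcd_sol.
  rewrite (sol_minn (adj G)) -/K; split; apply: eq_sol => u v; [exact: EA|by rewrite EA].
Qed.
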